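(* Let $d\in\mathbb{N}$, $d\ge2$, and $s>0$. For $n\ge2$ put $\alpha(n,d):=2+\log_2\big(\frac{d}{\log_2 n}+\frac12\big)$. Then for any $n\in\mathbb{N}$ with $2\le n\le\frac d2 4^d$ the two-sided estimate $$2^{-s}\Big(\frac1n\Big)^{\frac{s}{\alpha(n,d)}}\le a_n(I_d:H^{s,+}_{\rm mix}(\mathbb{T}^d)\to L_2(\mathbb{T}^d))\le\Big(\frac{e^2}{n}\Big)^{\frac{s}{4+2\log_2 d}}$$ holds.
   Context: $\mathbb{N}=\{1,2,3,\dots\}$. $\mathbb{T}^d$ is the $d$-torus, represented by $[0,2\pi]^d$ with opposite sides identified. $L_2(\mathbb{T}^d)$ carries the norm $\|f|L_2(\mathbb{T}^d)\|=(\int_{\mathbb{T}^d}|f(x)|^2dx)^{1/2}$, and for $f\in L_2(\mathbb{T}^d)$ the Fourier coefficients are $c_k(f)=(2\pi)^{-d/2}\int_{\mathbb{T}^d}f(x)e^{-ikx}dx$, $k\in\mathbb{Z}^d$ (so $\|f|L_2(\mathbb{T}^d)\|^2=\sum_k|c_k(f)|^2$). For $s>0$, $H^{s,+}_{\rm mix}(\mathbb{T}^d)$ is the space of all $f\in L_2(\mathbb{T}^d)$ for which the norm $$\|f|H^s_{\rm mix}(\mathbb{T}^d)\|^{+}=\Big[\sum_{k\in\mathbb{Z}^d}|c_k(f)|^2\prod_{j=1}^d(1+|k_j|^2)^{s}\Big]^{1/2}$$ is finite, equipped with this norm. $I_d$ denotes the identical embedding $f\mapsto f$. The approximation numbers of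 a bounded linear operator $T:X\to Y$ between Banach spaces are $a_n(T:X\to Y)=\inf\{\|T-A:X\to Y\| : A:X\to Y \text{ bounded linear},\ {\rm rank}\,A<n\}$, $n\in\mathbb{N}$. *)

(* Defs.v *)
From HB Require Import structures.
From mathcomp Require Import all_boot all_order all_algebra.
From mathcomp Require Import all_classical all_reals all_analysis.
From mathcomp.real_closed Require Import complex.

Set Implicit Arguments.
Unset Strict Implicit.
Unset Printing Implicit Defensive.

Import Order.TTheory GRing.Theory Num.Theory.
Import numFieldNormedType.Exports.

Local Open Scope classical_set_scope.
Local Open Scope ring_scope.
Local Open Scope complex_scope.

(* A normed space is presented by a linear subspace X of an ambient vector
   space and a seminorm nX, two elements of X at distance 0 being identified
   (for L_2: functions that agree almost everywhere).  Accordingly, linearity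
   and rank are stated up to seminorm 0: the operators A below are exactly the
   bounded linear operators between the quotient spaces, given on
   representatives.  The values of A outside X are irrelevant. *)
Section approximation_numbers.
Local Open Scope ereal_scope.
Context {R : realType} {E F : lmodType R[i]}.
Variables (X : set E) (nX : E -> \bar R) (Y : set F) (nY : F -> \bar R).

Definition bounded_linear_operator (A : E -> F) : Prop :=
  [/\ forall f, X f -> Y (A f),
      forall (a : R[i]) f g, X f -> X g ->
        nY (A (a *: f + g) - (a *: A f + A g))%R = 0
    & exists C : R, forall f, X f -> nY (A f) <= C%:E * nX f].

(* the range of A is contained in the span of fewer than n vectors of Y *)
Definition rank_lt (A : E -> F) (n : nat) : Prop :=
  exists2 m : nat, (m < n)%N & exists g : 'I_m -> F,
    (forall i, Y (g i)) /\
    forall f, X f ->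
      exists c : 'I_m -> R[i], nY (A f - \sum_(i < m) c i *: g i)%R = 0.

Definition operator_norm (A : E -> F) : \bar R :=
  ereal_sup [set nY (A f) | f in [set f | X f /\ nX f <= 1]].

Definition approximation_number (n : nat) (T : E -> F) : \bar R :=
  ereal_inf [set operator_norm (fun f => T f - A f)%R
    | A in [set A | bounded_linear_operator A /\ rank_lt A n]].

End approximation_numbers.

Section torus_measure.
Local Open Scope ereal_scope.
Variable R : realType.

Definition circle_measure : set (measurableTypeR R) -> \bar R :=
  mrestr lebesgue_measure (measurable_itv `[0%R, (2 * pi)%R]).

HB.instance Definition _ := Measure.on circle_measure.

Let circle_measure_fin : fin_num_fun circle_measure.
Proof.
apply: lty_fin_num_fun; rewrite /= /circle_measure /mrestr setTI.
by rewrite lebesgue_measure_itv/= lte_fin; case: ifPn => _; rewrite ?ltry.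
Qed.

HB.instance Definition _ :=
  Measure_isFinite.Build _ _ _ circle_measure circle_measure_fin.

Section cons_measure.
Variables (d : nat)
  (mu : {finite_measure set (d.-tuple (measurableTypeR R)) -> \bar R}).

Let consp (p : measurableTypeR R * d.-tuple (measurableTypeR R)) :
    d.+1.-tuple (measurableTypeR R) :=
  [tuple of p.1 :: p.2].

Let measurable_consp : measurable_fun setT consp.
Proof. exact: measurable_cons. Qed.

Definition cons_measure : set (d.+1.-tuple (measurableTypeR R)) -> \bar R :=
  pushforward (circle_measure \x mu) consp.

Let cons_measure0 : cons_measure set0 = 0.
Proof. by rewrite /cons_measure /pushforward preimage_set0 measure0. Qed.

Let cons_measure_ge0 A : 0 <= cons_measure A.
Proof. exact: measure_ge0. Qed.

Let cons_measure_sigma_additive : semi_sigma_additive cons_measure.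
Proof. by rewrite /cons_measure; exact: measure_semi_sigma_additive. Qed.

HB.instance Definition _ := isMeasure.Build _ _ _ cons_measure
  cons_measure0 cons_measure_ge0 cons_measure_sigma_additive.

Let cons_measure_fin : fin_num_fun cons_measure.
Proof.
apply: lty_fin_num_fun; rewrite /= /cons_measure /pushforward preimage_setT.
rewrite -setXTT [ltLHS]product_measure1E// lte_mul_pinfty// ?ltry.
- exact: fin_num_measure.
- by rewrite -ge0_fin_numE//; exact: fin_num_measure.
Qed.

HB.instance Definition _ :=
  Measure_isFinite.Build _ _ _ cons_measure cons_measure_fin.

End cons_measure.

(* d-dimensional Lebesgue measure concentrated on [0, 2 pi]^d *)
Fixpoint torus_measure (d : nat) :
    {finite_measure set (d.-tuple (measurableTypeR R)) -> \bar R} :=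
  match d with
  | 0 => dirac ([tuple] : 0.-tuple (measurableTypeR R))
  | d'.+1 => cons_measure (torus_measure d')
  end.

End torus_measure.

Section function_spaces.
Variables (R : realType) (d : nat).

Local Notation torus := (d.-tuple (measurableTypeR R)).
Local Notation mu := (torus_measure R d).
Local Notation normc := ComplexField.Normc.normc.

(* Functions on the torus are read on [0, 2 pi]^d: their values elsewhere do
   not matter, since mu does not charge the complement. *)
Definition L2_norm (f : torus -> R[i]) : \bar R :=
  ('N[mu]_2%:E[(fun x => (normc (f x))%:E)])%E.

Definition L2_space : set (torus -> R[i]) :=
  [set f : torus -> R[i] |
    [/\ measurable_fun setT (fun x => complex.Re (f x) : measurableTypeR R),
        measurable_fun setT (fun x => complex.Im (f x) : measurableTypeR R)
      & (L2_norm f < +oo)%E]].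

Definition complex_integral (f : torus -> R[i]) : R[i] :=
  (\int[mu]_x complex.Re (f x)) +i* (\int[mu]_x complex.Im (f x)).

(* exp (i t) *)
Definition expi (t : R) : R[i] := cos t +i* sin t.

Definition fourier_coef (k : d.-tuple int) (f : torus -> R[i]) : R[i] :=
  (((2 * pi) `^ (- (d%:R / 2)))%:C) *
  complex_integral
    (fun x => f x * expi (- \sum_(j < d) (tnth k j)%:~R * tnth x j)).

Definition Hmix_norm (s : R) (f : torus -> R[i]) : \bar R :=
  ((\esum_(k in [set: d.-tuple int])
      (normc (fourier_coef k f) ^+ 2 *
       \prod_(j < d) (1 + `|(tnth k j)%:~R| ^+ 2) `^ s)%:E) `^ 2^-1)%E.

Definition Hmix (s : R) : set (torus -> R[i]) :=
  [set f | L2_space f /\ (Hmix_norm s f < +oo)%E].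

End function_spaces.

Arguments L2_norm {R d}.
Arguments L2_space {R} d.
Arguments Hmix_norm {R d}.
Arguments Hmix {R} d.

Definition log2 {R : realType} (x : R) : R := ln x / ln 2.

Definition alpha {R : realType} (n d : nat) : R :=
  2 + log2 (d%:R / log2 n%:R + 2^-1).

(* Main.v *)
(* Upper bound.  With p := 2 + log2 d one has
     sum_k prod_j (1 + k_j^2)^(-p) <= (1 + 2 / d)^d <= e^2,
   because 2^(-log2 d) = 1 / d and (1 + x^2)^(-2) <= 1/x - 1/(x+1).  Hence fewer
   than n frequencies satisfy prod_j (1 + k_j^2)^(-p) > e^2 / n, and the Fourier
   projection onto these is a good enough operator, by Parseval's inequality.
   The latter amounts to the L_2-density of trigonometric polynomials:
   polynomials in cos (x_j - y) converge boundedly to the indicator of the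
   half-cylinder where this cosine is positive, these sets generate the Borel
   sets up to null sets, and the pi-lambda theorem applies.

   Lower bound.  On the span of n modes an operator of rank < n has a nonzero
   kernel, so a_n >= (2^m)^(-s) as soon as at least n frequencies satisfy
   prod_j (1 + |k_j|) <= 2^m.  Doubling one coordinate shows that at least
   sum_(i <= m) 2^i binom(i + d - 1, i) frequencies do, and for
   m := min(floor(1 + log2 n / alpha), d + 1) this number is at least n. *)

Require Import Defs.
From mathcomp Require Import all_boot all_order all_algebra.
From mathcomp Require Import all_classical all_reals all_analysis.
From mathcomp.real_closed Require Import complex.
From mathcomp Require Import measurable_realfun zify ring lra.
Import Order.TTheory GRing.Theory Num.Theory.
Import numFieldNormedType.Exports.
Set Implicit Arguments.
Unset Strict Implicit.
Unset Printing Implicit Defensive.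
Local Open Scope classical_set_scope.
Local Open Scope ring_scope.

(** * Counting frequencies *)

(** Completeness of the trigonometric system is the price of the upper bound, where the remainder of
    an arbitrary f has to be controlled by its Fourier coefficients. The lower bound tests operators
    on finite combinations of modes, where orthonormality decides. Its obstacle is different: the
    competing operators are linear and of finite rank only modulo null functions, so a kernel vector
    is also one only modulo null functions. The constants come from passing between norms and their
    squares. By 1 + x^2 <= (1 + |x|)^2, a frequency with prod_j (1 + |k_j|) <= 2^m has weight at
    most 2^(2 m s) in the squared norm, and the square root of this is 2^(m s). Rounding to an
    integer level costs the factor 2 in 2^m <= 2 n^(1 / alpha), hence 2^(-s) in the estimate. In the
    upper bound the square root turns the exponent s / p into s / (2 p), and 2 p = 4 + 2 log2 d. *)

Section hyperbolic_cross.
Local Open Scope nat_scope.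

(** Arrange the integers in a binary tree with root 0, the children of x being [odd_child x] and
    [even_child x]: depth r has 2^r nodes, all with |x| + 1 <= 2^r. Summand i is the number of
    d-tuples of total depth i, namely binom(i + d - 1, i) distributions of i over the coordinates
    times 2^i choices of nodes. *)
Definition cross_size m d := \sum_(i < m.+1) 2 ^ i * 'C((i + d).-1, i).

Lemma cross_size0 d : cross_size 0 d = 1.
Proof. by rewrite /cross_size big_ord_recl big_ord0 bin0. Qed.

Lemma cross_sizen0 m : cross_size m 0 = 1.
Proof.
rewrite /cross_size big_ord_recl bin0 big1 // => i _.
by rewrite addn0 bin_small ?muln0.
Qed.

(** Pascal's rule, summand by summand. In terms of tuples: a head 0 leaves a tail in dimension d at
    the same level, and any other head has a unique parent one level lower, each parent having two
    children. *)
Lemma cross_sizeS m d :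
  cross_size m.+1 d.+1 = cross_size m.+1 d + 2 * cross_size m d.+1.
Proof.
rewrite /cross_size big_ord_recl [in RHS]big_ord_recl /= !bin0 -addnA.
congr (_ + _); rewrite big_distrr -big_split /=; apply: eq_bigr => i _.
by rewrite /bump /= !add1n add0n addnS binS expnS /= mulnDr !mulnA.
Qed.

Definition cross_weight d (k : d.-tuple int) := \prod_(j < d) (absz (tnth k j)).+1.

Lemma cross_weight_cons d x (k : d.-tuple int) :
  cross_weight [tuple of x :: k] = (absz x).+1 * cross_weight k.
Proof.
rewrite /cross_weight big_ord_recl tnth0; congr (_ * _).
by apply: eq_bigr => i _; rewrite tnthS.
Qed.

Definition on_head d (f : int -> int) (k : d.+1.-tuple int) :=
  [tuple of f (thead k) :: behead k].

Lemma on_headE d f x (k : d.-tuple int) :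
  on_head f [tuple of x :: k] = [tuple of f x :: k].
Proof. by apply: val_inj. Qed.

(* [odd_child] and [even_child] have disjoint ranges avoiding 0, whence the
   doubling in [cross_sizeS]. *)
Definition odd_child (x : int) : int := if (0 <= x)%R then (2 * x + 1)%R else (2 * x - 1)%R.
Definition even_child (x : int) : int := if x == 0%R then (-1)%R else (2 * x)%R.

(** An explicit list, since the lower bound has to pick n modes from it. The weight bound survives
    the recursion because moving the head x to one of its children at most doubles the factor |x| +
    1. *)
Lemma hyperbolic_cross_seq m d : exists l : seq (d.-tuple int),
  [/\ uniq l, forall k, k \in l -> cross_weight k <= 2 ^ m & size l = cross_size m d].
Proof.
elim: d m => [|d IHd] m.
  exists [:: [tuple]]; split => //; last by rewrite cross_sizen0.
  by move=> k _; rewrite /cross_weight big_ord0 expn_gt0.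
elim: m => [|m [l2 [ul2 wl2 sl2]]].
  exists [:: [tuple of nseq d.+1 0%R]]; split => //; last by rewrite cross_size0.
  move=> k; rewrite inE => /eqP ->; rewrite /cross_weight big1 // => i _.
  by rewrite (tnth_nth 0%R) nth_nseq if_same.
have [l1 [ul1 wl1 sl1]] := IHd m.+1.
pose c0 (k : d.-tuple int) := [tuple of 0%R :: k].
exists (map c0 l1 ++ map (on_head odd_child) l2 ++ map (on_head even_child) l2).
have headE f (k : d.+1.-tuple int) : thead (on_head f k) = f (thead k).
  by rewrite theadE.
have inj_on f : injective f -> injective (@on_head d f).
  move=> fi k k'; case/tupleP: k => x k; case/tupleP: k' => x' k'.
  rewrite !on_headE => /(congr1 val) [] /fi -> kk'.
  by congr [tuple of _ :: _]; apply: val_inj.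
have oddi : injective odd_child by move=> x y; rewrite /odd_child; do 2 case: ifP; lia.
have eveni : injective even_child by move=> x y; rewrite /even_child; do 2 case: ifP; lia.
split.
- rewrite !cat_uniq !map_inj_uniq ?ul1 ?ul2 //=; last first.
  + by move=> k k' /(congr1 val) [] kk'; apply: val_inj.
  + exact: inj_on.
  + exact: inj_on.
  rewrite andbT; apply/andP; split; apply/hasPn => k.
    rewrite mem_cat => /orP[] /mapP[k' _ ->]; apply/mapP => -[t _];
      move/(congr1 (fun u => thead u)); rewrite headE theadE;
      rewrite /odd_child /even_child; case: ifP; lia.
  move=> /mapP[k' _ ->]; apply/mapP => -[t _].
  move/(congr1 (fun u => thead u)); rewrite !headE.
  by rewrite /odd_child /even_child; do 2 case: ifP; lia.
- have wch f : (forall x, absz (f x) < 2 * (absz x).+1) ->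
      forall k, k \in map (on_head f) l2 -> cross_weight k <= 2 ^ m.+1.
    move=> hf k /mapP[k' k'l ->]; move: (wl2 _ k'l).
    case/tupleP: k' {k'l} => x k'; rewrite on_headE !cross_weight_cons expnS => h.
    apply: leq_trans (leq_mul (leqnn 2) h); rewrite mulnA leq_mul2r.
    by rewrite hf orbT.
  move=> k; rewrite !mem_cat => /or3P[/mapP[k' k'l ->]| |].
  + by rewrite cross_weight_cons mul1n wl1.
  + by apply: wch => x; rewrite /odd_child; case: ifP; lia.
  + by apply: wch => x; rewrite /even_child; case: ifP; lia.
- by rewrite !size_cat !size_map sl1 sl2 cross_sizeS; lia.
Qed.

Lemma cross_size_ge m d : 2 ^ m * 'C((m + d).-1, m) <= cross_size m d.
Proof. by rewrite /cross_size big_ord_recr leq_addl. Qed.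

Lemma cross_size1 d : cross_size 1 d = 1 + 2 * d.
Proof. by rewrite /cross_size !big_ord_recr big_ord0 /= bin0 bin1. Qed.

Lemma cross_size2 d : 0 < d -> cross_size 2 d = 1 + 2 * d + 2 * (d * d.+1).
Proof.
move=> d0; rewrite /cross_size !big_ord_recr big_ord0 /= bin0 bin1 bin2.
by rewrite /= -divn2; have := odd_double_half (d.+1 * d); rewrite oddM /= andNb; lia.
Qed.

Lemma bin_prod m d : 'C(m + d, m) * m`! = \prod_(i < m) (d + i.+1).
Proof.
apply/eqP; rewrite -(@eqn_pmul2r d`!) ?fact_gt0 //; apply/eqP.
rewrite -mulnA; have := bin_fact (leq_addr d m); rewrite addKn => ->.
elim: m => [|m IH]; first by rewrite big_ord0 mul1n.
by rewrite addSn factS IH big_ord_recr /=; lia.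
Qed.

(** After multiplication by m!, the factors compare as (m + d)(i + 1) <= m (d + i + 1), the
    difference being d (m - i - 1). At i = 0 the gap is large enough to absorb the factor 2; this is
    where 2 < m <= d enters. *)
Lemma cross_size_bin m d : 2 < m <= d -> 2 * (m + d) ^ m <= m ^ m * 'C(m + d, m).
Proof.
move=> /andP[m2 md]; rewrite -(@leq_pmul2r m`!) ?fact_gt0 // -[leqRHS]mulnA bin_prod.
have cstE x : x ^ m = \prod_(i < m) x by rewrite prod_nat_const card_ord.
rewrite fact_prod big_add1 big_mkord -mulnA !cstE -!big_split /=.
case: m m2 md {cstE} => // m m2 md; rewrite !big_ord_recl mulnA.
apply: leq_mul.
  rewrite /= muln1 addn1; have := leq_mul m2 (leqnn d.-1); nia.
apply: leq_prod => i _; rewrite lift0; have := leq_mul (ltn_ord i) (leqnn d); nia.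
Qed.

(* For [2 < m], [cross_size_bin] comes from comparing the factors of
   ['C(m + d, m)] one by one; for [m = 1, 2] the summand [+ 1] is needed. *)
Lemma cross_size_low m d : 1 < d -> 0 < m <= d ->
  2 ^ m * (m + d) ^ m <= m ^ m * (cross_size m d).+1.
Proof.
move=> d1 /andP[m0 md]; have [m2|] := ltnP 2 m.
  have h1 := cross_size_bin (introT andP (conj m2 md)).
  (* For m <= d the two terms of Pascal's rule satisfy binom(m + d - 1, m - 1) <= binom(m + d - 1,
     m). Passing to the upper index m + d - 1 of the last summand thus costs exactly the factor 2
     gained in [cross_size_bin]. *)
  have h2 : 'C(m + d, m) <= 2 * 'C((m + d).-1, m).
    case: m m0 md {h1 m2} => // m _ md; rewrite addSn binS /=.
    have := mul_bin_left (m + d) m; rewrite addKn => e.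
    have : m.+1 * 'C(m + d, m) <= m.+1 * 'C(m + d, m.+1) by rewrite e leq_mul2r md orbT.
    by rewrite leq_pmul2l //; lia.
  have h3 := cross_size_ge m d.
  move: h1 h2 h3; move: (2 ^ m) ((m + d) ^ m) (m ^ m) 'C(_, _) 'C(_, _) (cross_size m d).
  move=> a b c e f g h1 h2 h3.
  have := leq_mul (leqnn a) h1; have := leq_mul (leqnn (a * c)) h2.
  have := leq_mul (leqnn c) h3; nia.
case: m m0 md => [|[|[|m]]] // _ md _; first by rewrite cross_size1; lia.
by rewrite cross_size2 //; lia.
Qed.

(** The last summand 2^(d + 1) binom(2 d, d + 1) is already large enough. This is the origin of the
    range n <= d / 2 * 4^d: level d + 1 holds n frequencies for all such n. *)
Lemma cross_size_diag d : 0 < d -> d * 4 ^ d <= 2 * cross_size d.+1 d.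
Proof.
move=> d0; have h : d * 2 ^ d <= 4 * 'C(d.*2, d.+1).
  elim: d d0 => // -[|d] IHd _ //.
  have bl := mul_bin_left d.+1.*2 d.+1; have := IHd isT; rewrite [_ ^ d.+2]expnS.
  (* Pascal's rule applied twice relates consecutive binomials binom(2 d, d + 1). *)
  have -> : 'C(d.+2.*2, d.+3) =
      'C(d.+1.*2, d.+3) + 2 * 'C(d.+1.*2, d.+2) + 'C(d.+1.*2, d.+1).
    by rewrite [d.+2.*2]doubleS; move: (d.+1.*2) => N; rewrite !binS; lia.
  have h1 : 'C(d.+1.*2, d.+2) <= 'C(d.+1.*2, d.+1).
    have e : d.+1.*2 - d.+1 = d.+1 by lia.
    by rewrite -(@leq_pmul2l d.+2) // bl e leq_mul2r leqnSn orbT.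
  nia.
have := cross_size_ge d.+1 d.
have -> : (d.+1 + d).-1 = d.*2 by lia.
rewrite expnS; have -> : 4 ^ d = 2 ^ d * 2 ^ d by rewrite -expnMn.
nia.
Qed.

End hyperbolic_cross.

(** * Choice of the level for n frequencies; summation of the weights *)

Section level_estimates.
Variable R : realType.

Lemma ln2_gt0 : 0 < ln 2 :> R.
Proof. by rewrite ln_gt0 // ltr1n. Qed.

(** Since [alpha n d] itself contains log2 n, the argument is by contradiction. For m <= d the count
    at level m, plus 1, is at least (2 t)^m with t = (m + d) / m >= 2. Were the count less than n at
    m = floor(1 + log2 n / alpha), then m (1 + log2 t) <= log2 n, hence 2 m <= log2 n. As 1 + log2 t
    = 2 + log2 (d / (2 m) + 1 / 2), this gives alpha <= 1 + log2 t and so m alpha <= log2 n,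
    contrary to the choice of m. *)
Lemma cross_level (d n : nat) : (1 < d)%N -> (1 < n)%N ->
  n%:R <= d%:R / 2 * 4 ^+ d :> R ->
  0 < alpha n d :> R /\
  exists2 m, (n <= cross_size m d)%N & 2 ^+ m <= 2 * n%:R `^ (alpha n d)^-1 :> R.
Proof.
move=> d1 n1 nd; have l2 := ln2_gt0.
have n0 : 0 < n%:R :> R by rewrite ltr0n ltnW.
have d0 : 0 < d%:R :> R by rewrite ltr0n ltnW.
set L := log2 n%:R : R; have L1 : 1 <= L.
  by rewrite /L /log2 ler_pdivlMr // mul1r ler_ln ?posrE // ler_nat.
have Lln : ln n%:R = L * ln 2 :> R by rewrite /L /log2 divfK // gt_eqF.
set a := alpha n d : R; have a1 : 1 <= a.
  rewrite /a /alpha -/L /log2.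
  suff : -1 <= ln (d%:R / L + 2^-1) / ln 2 by lra.
  rewrite ler_pdivlMr // mulN1r -lnV ?posrE // ler_ln ?posrE ?invr_gt0 //; last first.
    by rewrite addr_gt0 // divr_gt0 // (lt_le_trans _ L1).
  by rewrite lerDr divr_ge0 // ltW // (lt_le_trans _ L1).
have a0 : 0 < a by exact: lt_le_trans a1.
split=> //.
have pow m : m%:R <= 1 + L / a -> 2 ^+ m <= 2 * n%:R `^ a^-1 :> R.
  move=> hm; rewrite -ler_ln ?posrE ?exprn_gt0 ?mulr_gt0 ?powR_gt0 //.
  rewrite lnXn // lnM ?posrE ?powR_gt0 // ln_powR Lln -[ln 2 *+ m]mulr_natr.
  have -> : ln 2 + a^-1 * (L * ln 2) = ln 2 * (1 + L / a) by ring.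
  by rewrite ler_pM2l.
have La0 : 0 <= 1 + L / a by rewrite addr_ge0 // divr_ge0 // ltW // (lt_le_trans _ L1).
have /andP[m_le m_gt] := Num.Theory.truncn_itv La0.
set m := Num.truncn (1 + L / a) in m_le m_gt.
have [dm|md] := ltnP d m.
  exists d.+1; last first.
    by apply: pow; apply: le_trans m_le; rewrite ler_nat.
  have := cross_size_diag (ltnW d1).
  rewrite -(ler_nat R) !natrM natrX => h.
  rewrite -(ler_nat R); apply: le_trans nd _.
  by move: h; set X := 4 ^+ d; lra.
have m0 : (0 < m)%N.
  by rewrite /m Num.Theory.truncn_gt0 lerDl divr_ge0 // ltW // (lt_le_trans _ L1).
exists m; last exact: pow.
rewrite leqNgt; apply/negP => hn.
have m0R : 0 < m%:R :> R by rewrite ltr0n.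
(* The negated goal [cross_size m d < n] bounds exactly the successor that occurs in
   [cross_size_low]. *)
have := cross_size_low d1 (introT andP (conj m0 md)).
move=> /leq_trans /(_ (leq_mul (leqnn (m ^ m)%N) hn)).
rewrite -(ler_nat R) !natrM !natrX natrD => h.
set t := (m%:R + d%:R) / m%:R : R.
have t0 : 0 < t by rewrite divr_gt0 // addr_gt0.
have Lm : m%:R * (ln 2 + ln t) <= L * ln 2.
  have t20 : 0 < 2 * t by rewrite mulr_gt0.
  rewrite -Lln -lnM ?posrE // [leLHS]mulr_natl -(lnXn m t20).
  rewrite ler_ln ?posrE ?exprn_gt0 // exprMn /t expr_div_n mulrA ler_pdivrMr ?exprn_gt0 //.
  by rewrite [X in _ <= X]mulrC.
have t2 : ln 2 <= ln t.
  rewrite ler_ln ?posrE // /t ler_pdivlMr // mulr_natl mulr2n lerD2l ler_nat //.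
have L2m : 2 * m%:R <= L.
  rewrite -(ler_pM2r l2); apply: le_trans Lm; rewrite [2 * m%:R]mulrC -mulrA ler_pM2l //.
  by rewrite mulr_natl mulr2n lerD2l.
have ab : a * ln 2 <= ln 2 + ln t.
  rewrite /a /alpha -/L /log2 mulrDl divfK ?gt_eqF //.
  have -> : ln t = ln 2 + ln (t / 2).
    by rewrite -lnM ?posrE // ?(divr_gt0 t0 (ltr0Sn _ 1)) //; congr ln; field.
  rewrite mulr_natl mulr2n -addrA !lerD2l ler_ln ?posrE ?(divr_gt0 t0 (ltr0Sn _ 1)) //; last first.
    by rewrite addr_gt0 // divr_gt0 // (lt_le_trans _ L1).
  have -> : t / 2 = d%:R / (2 * m%:R) + 2^-1 by rewrite /t; field; rewrite gt_eqF.
  have L0 : 0 < L by exact: lt_le_trans L1.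
  have m20 : 0 < 2 * m%:R :> R by rewrite mulr_gt0.
  by rewrite lerD2r ler_pM2l // lef_pV2 ?posrE.
have : L < m%:R * a.
  by rewrite -ltr_pdivrMr //; move: m_gt; rewrite -natr1 addrC ltrD2r.
rewrite ltNge -(ler_pM2r l2) => /negP; apply; apply: le_trans Lm.
by rewrite -mulrA ler_pM2l.
Qed.

Lemma log2_ge0 (d : nat) : (0 < d)%N -> 0 <= log2 d%:R :> R.
Proof. by move=> d0; rewrite divr_ge0 ?ln_ge0 ?ler1n // ltW // ln2_gt0. Qed.

Lemma powR_powlog_le (d x : nat) : (0 < d)%N -> (0 < x)%N ->
  (1 + x%:R ^+ 2) `^ (- (2 + log2 d%:R)) <= d%:R^-1 * (x%:R^-1 - x.+1%:R^-1) :> R.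
Proof.
move=> d0 x0; have l2 := ln2_gt0.
have x0R : 0 < x%:R :> R by rewrite ltr0n.
have y2 : 2 <= 1 + x%:R ^+ 2 :> R.
  by have : 1 <= x%:R :> R by [rewrite ler1n]; nra.
set y := 1 + _ in y2 *.
have y0 : 0 < y by lra.
rewrite opprD powRD; last by rewrite (gt_eqF y0) implybT.
rewrite mulrC; apply: ler_pM; rewrite ?powR_ge0 //.
  have -> : d%:R^-1 = 2 `^ (- log2 d%:R) :> R.
    rewrite powRN; congr (_^-1); rewrite /powR pnatr_eq0 /log2 divfK ?gt_eqF //.
    by rewrite lnK // posrE ltr0n.
  rewrite !powRN lef_pV2 ?posrE ?powR_gt0 //.
  by apply: ge0_ler_powR; rewrite ?nnegrE ?log2_ge0 //; lra.
rewrite powRN powR_mulrn ?(ltW y0) //.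
have -> : x%:R^-1 - x.+1%:R^-1 = (x%:R * x.+1%:R)^-1 :> R.
  by rewrite -natr1; field; rewrite !gt_eqF // ltr_wpDl // ltW.
rewrite lef_pV2 ?posrE ?exprn_gt0 ?mulr_gt0 // -natr1 /y; nra.
Qed.

(** The frequency 0 contributes 1; the positive and the negative half of the window each telescope
    to at most 1 / d. *)
Lemma sum_powlog_le (d M : nat) : (0 < d)%N ->
  \sum_(x <- [seq (i%:Z - M%:Z)%R | i <- iota 0 (2 * M).+1])
     (1 + `|x%:~R| ^+ 2) `^ (- (2 + log2 d%:R)) <= 1 + 2 / d%:R :> R.
Proof.
move=> d0; pose w (x : R) := (1 + `|x| ^+ 2) `^ (- (2 + log2 d%:R)) : R.
rewrite (eq_bigr (fun x => w x%:~R)) //.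
have tel N : \sum_(0 <= i < N) w (i.+1)%:R <= d%:R^-1 * (1 - N.+1%:R^-1).
  elim: N => [|N IH]; first by rewrite big_nil invr1 subrr mulr0.
  rewrite big_nat_recr //=; apply: le_trans (lerD IH _) _.
    by rewrite /w normr_nat; apply: powR_powlog_le.
  by rewrite -mulrDr addrA subrK.
have half N : \sum_(0 <= i < N) w (i.+1)%:R <= d%:R^-1.
  by apply: le_trans (tel N) _; rewrite ler_piMr ?invr_ge0 //.
have wN x : w (- x) = w x by rewrite /w normrN.
have -> : (2 * M).+1 = (M + M.+1)%N by lia.
rewrite iotaD map_cat big_cat /= !big_map.
have -> : \sum_(j <- iota 0 M) w (j%:Z - M%:Z)%:~R = \sum_(0 <= i < M) w i.+1%:R.
  rewrite [RHS]big_nat_rev /= add0n {1}/index_iota subn0 big_seq [RHS]big_seq.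
  apply: eq_bigr => i; rewrite mem_iota add0n => /andP[_ iM].
  rewrite -wN -rmorphN /= opprB; congr w.
  by rewrite [RHS]pmulrn; congr (_%:~R); lia.
rewrite add0n big_cons subrr.
have -> : iota M.+1 M = [seq (M + i.+1)%N | i <- iota 0 M].
  by rewrite -addn1 iotaDl (iotaDl 1 0) -map_comp.
rewrite -map_comp big_map.
have -> : w 0%:~R = 1 by rewrite /w normr0 expr0n addr0 powR1.
have -> : \sum_(j <- iota 0 M) w ((M + j.+1)%:Z - M%:Z)%:~R = \sum_(0 <= i < M) w i.+1%:R.
  rewrite /index_iota subn0; apply: eq_bigr => i _; congr w.
  by rewrite [RHS]pmulrn; congr (_%:~R); lia.
have := half M; rewrite [2 / _]mulrDl mul1r; lra.
Qed.

(** The list is enlarged to a full cube [-M, M]^d, on which the sum of products factors into a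
    product of sums. *)
Lemma sum_prod_tuple_le (d : nat) (w : int -> R) (C : R) (l : seq (d.-tuple int)) :
  (forall x, 0 <= w x) ->
  (forall M : nat, \sum_(x <- [seq (i%:Z - M%:Z)%R | i <- iota 0 (2 * M).+1]) w x <= C) ->
  uniq l -> \sum_(k <- l) \prod_(j < d) w (tnth k j) <= C ^+ d.
Proof.
move=> w0 wC ul.
pose M := (\max_(k <- l) \max_(j < d) absz (tnth k j))%N.
have kM k j : k \in l -> (absz (tnth k j) <= M)%N.
  move=> kl; apply: (@leq_trans (\max_(j < d) absz (tnth k j))%N).
    exact: (@leq_bigmax _ (fun j => absz (tnth k j))).
  exact: (@leq_bigmax_seq _ l xpredT (fun k => \max_(j < d) absz (tnth k j))%N).
clearbody M; pose dec (i : 'I_(2 * M).+1) : int := i%:Z - M%:Z.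
pose enc (k : d.-tuple int) : {ffun 'I_d -> 'I_(2 * M).+1} :=
  [ffun j => inord (absz (tnth k j + M%:Z))].
have decK k j : k \in l -> dec (enc k j) = tnth k j.
  move=> kl; rewrite /dec ffunE inordK; have := kM k j kl; move: (tnth k j) => x; lia.
pose G (f : {ffun 'I_d -> 'I_(2 * M).+1}) := \prod_(j < d) w (dec (f j)).
have -> : \sum_(k <- l) \prod_(j < d) w (tnth k j) = \sum_(f <- map enc l) G f.
  rewrite big_map big_seq [RHS]big_seq; apply: eq_bigr => k kl.
  by apply: eq_bigr => j _; rewrite decK.
have ue : uniq (map enc l).
  rewrite map_inj_in_uniq // => k k' kl k'l ekk'; apply: eq_from_tnth => j.
  by rewrite -!decK // ekk'.
rewrite big_uniq //=; apply: (@le_trans _ _ (\sum_f G f)).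
  rewrite [leLHS]big_mkcond /=; apply: ler_sum => f _; case: ifP => // _.
  exact: prodr_ge0.
rewrite /G -(bigA_distr_bigA (fun (j : 'I_d) x => w (dec x))) prodr_const card_ord.
rewrite lerXn2r ?nnegrE ?sumr_ge0 //.
  by apply: le_trans (wC 0%N); rewrite sumr_ge0.
apply: le_trans (wC M); rewrite big_map.
by rewrite -(big_mkord xpredT (fun i => w (i%:Z - M%:Z))) /index_iota subn0.
Qed.

(** The bound on the sizes provides a longest duplicate-free list of elements satisfying [P]; an
    element of [P] outside it could be added. This lists the large weights without talking about
    finite sets. *)
Lemma maximal_uniq_seq (T : eqType) (P : T -> Prop) (n : nat) :
  (forall l : seq T, uniq l -> {in l, forall x, P x} -> (size l < n)%N) ->
  exists l : seq T, [/\ uniq l, (size l < n)%N & forall x, x \notin l -> ~ P x].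
Proof.
move=> Pn; pose Q (k : nat) := `[<exists l : seq T,
  [/\ uniq l, {in l, forall x, P x} & size l = k]>].
have exQ : exists k, Q k by exists 0%N; apply/asboolP; exists [::].
have bQ k : Q k -> (k <= n)%N.
  by move=> /asboolP[l [ul Pl <-]]; exact/ltnW/Pn.
have [k /asboolP[l [ul Pl sl]] kmax] := ex_maxnP exQ bQ.
exists l; split=> [//||x xl Px]; first exact: Pn.
suff /kmax : Q k.+1 by rewrite ltnn.
apply/asboolP; exists (x :: l); split; rewrite /= ?xl ?sl //.
by move=> y; rewrite inE => /predU1P[->|/Pl].
Qed.

Lemma large_weight_seq (d n : nat) : (0 < d)%N -> (0 < n)%N ->
  exists l : seq (d.-tuple int), [/\ uniq l, (size l < n)%N &
    forall k, k \notin l ->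
      \prod_(j < d) (1 + `|(tnth k j)%:~R| ^+ 2) `^ (- (2 + log2 d%:R))
        <= expR 1 ^+ 2 / n%:R :> R].
Proof.
move=> d0 n0.
pose w (x : int) : R := (1 + `|x%:~R| ^+ 2) `^ (- (2 + log2 d%:R)).
have [l ul dl|l [ul ln hl]] := @maximal_uniq_seq (d.-tuple int)
    (fun k => expR 1 ^+ 2 / n%:R < \prod_(j < d) w (tnth k j)) n; last first.
  by exists l; split=> // k /hl /negP; rewrite -leNgt.
have n0R : 0 < n%:R :> R by rewrite ltr0n.
(* Strictness of the comparison of sums below comes from one element of [l], so the empty list is
   treated apart. *)
have [->//|l0] := eqVneq l [::].
have := @sum_prod_tuple_le d w (1 + 2 / d%:R) l (fun x => powR_ge0 _ _)
  (fun M => sum_powlog_le M d0) ul.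
have : (1 + 2 / d%:R) ^+ d <= expR 1 ^+ 2 :> R.
  apply: (@le_trans _ _ (expR (2 / d%:R) ^+ d)).
    by rewrite lerXn2r ?nnegrE ?expR_ge0 ?expR_ge1Dx // addr_ge0 // divr_ge0.
  by rewrite -!expRM_natl mulr1 mulrCA divff ?mulr1 // pnatr_eq0 -lt0n.
move=> h1 /le_trans /(_ h1) {h1} h.
rewrite -(ltr_nat R) -(ltr_pM2r (_ : 0 < expR 1 ^+ 2 / n%:R)); last first.
  by rewrite divr_gt0 // exprn_gt0 // expR_gt0.
rewrite [ltRHS]mulrC divfK ?gt_eqF //; apply: lt_le_trans h.
case: l l0 {ul} dl => // k l _ dl.
rewrite -sum1_size natr_sum mulr_suml !big_cons mul1r ltr_leD ?dl ?mem_head //.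
rewrite big_seq [leRHS]big_seq ler_sum // => k' k'l.
by rewrite ltW // dl // inE k'l orbT.
Qed.

End level_estimates.

(** * Integration on the torus *)

Section circle.
Variable R : realType.
Local Notation pt d := (d.-tuple (measurableTypeR R)).

Definition dot d (k : d.-tuple int) (x : pt d) : R :=
  \sum_(j < d) (tnth k j)%:~R * tnth x j.

Lemma measurable_dot d (k : d.-tuple int) : measurable_fun setT (dot k : pt d -> measurableTypeR R).
Proof.
apply: measurable_sum => j; apply: measurable_funM => //.
exact: measurable_tnth.
Qed.

Lemma measurable_cosD d (T : measurableType d) (g : T -> measurableTypeR R) (t : R) :
  measurable_fun setT g ->
  measurable_fun setT (fun x => cos (g x + t) : measurableTypeR R).
Proof.
move=> mg; apply: (@measurableT_comp _ _ _ _ _ _ (@cos R)).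
  by apply: continuous_measurable_fun; exact: continuous_cos.
exact: measurable_funD.
Qed.

Lemma bounded_integrable d (T : measurableType d) (mu : {finite_measure set T -> \bar R})
    (g : T -> measurableTypeR R) (C : R) :
  measurable_fun setT g -> (forall x, `|g x| <= C) ->
  mu.-integrable setT (EFin \o g).
Proof.
move=> mg gC; apply: (@le_integrable _ _ _ mu _ measurableT (EFin \o g) (EFin \o cst C)) => //.
- exact/measurable_EFinP.
- by move=> x _; rewrite /= lee_fin (le_trans (gC x)) // ler_norm.
- exact: finite_measure_integrable_cst.
Qed.

Lemma pi2_gt0 : 0 < 2 * pi :> R.
Proof. by rewrite mulr_gt0 // pi_gt0. Qed.

Lemma circle_setC : @circle_measure R (~` `[0, 2 * pi]) = 0%E.
Proof. by rewrite /circle_measure /mrestr setICl measure0. Qed.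

Lemma circle_integralE (f : measurableTypeR R -> \bar R) :
  (@circle_measure R).-integrable setT f ->
  (\int[@circle_measure R]_t f t = \int[@lebesgue_measure R]_(t in `[0%R, (2 * pi)%R]) f t)%E.
Proof.
move=> fi; rewrite (negligible_integral _ _ fi circle_setC) //; last first.
  by apply: measurableC; exact: measurable_itv.
rewrite setTD setCK; apply: eq_measure_integral => A mA A0.
by rewrite -[LHS]/(lebesgue_measure (A `&` `[0, 2 * pi])) setIidl.
Qed.

Lemma sin_2piz (m : int) (t : R) : sin (m%:~R * (2 * pi) + t) = sin t.
Proof.
have h n x : sin (x + n%:R * (2 * pi)) = sin x :> R.
  elim: n => [|n IH]; first by rewrite mul0r addr0.
  by rewrite -natr1 mulrDl mul1r addrA {2}(mulr_natl pi 2) sinD2pi IH.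
by case: m => m; rewrite addrC; [rewrite h|rewrite NegzE mulrNz mulNr -(h m.+1) subrK].
Qed.

(** The phase t lets one formula cover sine and cosine, and it closes the induction on the dimension
    in [torus_cos], where the remaining coordinates are absorbed into the phase. *)
Lemma circle_cos (m : int) (t : R) :
  (\int[@circle_measure R]_x (cos (m%:~R * x + t))%:E =
    (if m == 0%R then 2 * pi * cos t else 0)%R%:E)%E.
Proof.
have mid : measurable_fun setT (fun x : measurableTypeR R => m%:~R * x : measurableTypeR R).
  exact: measurable_funM.
rewrite circle_integralE; last first.
  by apply: (@bounded_integrable _ _ _ _ 1); [exact: measurable_cosD|move=> x; exact: cos_max].
case: eqP => [->|/eqP m0].
  under eq_integral do rewrite mul0r add0r.
  rewrite integral_cst //= lebesgue_measure_itv /= lte_fin pi2_gt0 -EFinD subr0.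
  by rewrite -EFinM mulrC.
have mR0 : m%:~R != 0 :> R by rewrite intr_eq0.
have dF (x : R) : is_derive x 1 (fun x : R => sin (m%:~R * x + t) / m%:~R) (cos (m%:~R * x + t)).
  by apply: is_derive_eq; rewrite !scaler0 /= /GRing.scale /= !(mulr0, add0r, addr0) mulr1; field.
rewrite (@continuous_FTC2 _ _ (fun x => sin (m%:~R * x + t) / m%:~R)) ?pi2_gt0 //.
- by rewrite sin_2piz mulr0 add0r -EFinB subrr.
- apply: continuous_subspaceT => x; apply: continuous_comp; last exact: continuous_cos.
  by apply: continuousD; [exact: mulrl_continuous|exact: cvg_cst].
- have cF : continuous (fun x : R => sin (m%:~R * x + t) / m%:~R).
    by move=> x; apply: differentiable_continuous; apply/derivable1_diffP; have [] := dF x.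
  split; first by move=> x _; have [] := dF x.
    exact/cvg_at_right_filter/cF.
  exact/cvg_at_left_filter/cF.
- by move=> x _; rewrite derive1E; have [] := dF x.
Qed.

End circle.

Section torus_integration.
Variable R : realType.
Local Notation pt d := (d.-tuple (measurableTypeR R)).

Lemma dot_cons d (m : int) (k : d.-tuple int) (t : measurableTypeR R) (x : pt d) :
  dot [tuple of m :: k] [tuple of t :: x] = m%:~R * t + dot k x.
Proof.
by rewrite /dot big_ord_recl !tnth0; congr (_ + _); apply: eq_bigr => j _; rewrite !tnthS.
Qed.

Let tc d (p : measurableTypeR R * pt d) : pt d.+1 := [tuple of p.1 :: p.2].

Lemma measurable_tc d : measurable_fun setT (@tc d).
Proof. exact: measurable_cons. Qed.

Lemma torus_integralS d (f : pt d.+1 -> \bar R) :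
  (torus_measure R d.+1).-integrable setT f ->
  (\int[torus_measure R d.+1]_x f x =
   \int[torus_measure R d]_x \int[@circle_measure R]_t f [tuple of t :: x])%E.
Proof.
move=> /integrableP[mf fi]; pose nu := (@circle_measure R \x torus_measure R d)%E.
have fi' : nu.-integrable setT (f \o @tc d).
  apply/integrableP; split; first by apply: measurableT_comp => //; exact: measurable_tc.
  move: fi; rewrite -[X in (X < _)%E -> _]/(\int[pushforward nu (@tc d)]_x `|f x|)%E.
  rewrite ge0_integral_pushforward //; first exact: measurable_tc.
  exact: measurableT_comp.
rewrite -[LHS]/(\int[pushforward nu (@tc d)]_x f x)%E.
rewrite integral_pushforward //; last exact: measurable_tc.
by rewrite preimage_setT -(integral21_prod_meas1 fi').
Qed.

Lemma torus_cos d (k : d.-tuple int) (t : R) :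
  (\int[torus_measure R d]_x (cos (dot k x + t))%:E =
    (if all (pred1 0%R) k then (2 * pi) ^+ d * cos t else 0)%R%:E)%E.
Proof.
elim: d k t => [|d IH] k t.
  rewrite integral_dirac //; last first.
    by apply/measurable_EFinP; apply: measurable_cosD; exact: measurable_dot.
  by rewrite diracT mul1e tuple0 /= /dot big_ord0 add0r expr0 mul1r.
case/tupleP: k => m k; rewrite torus_integralS; last first.
  apply: (@bounded_integrable _ _ _ _ _ 1); last by move=> x; exact: cos_max.
  by apply: measurable_cosD; exact: measurable_dot.
under eq_integral => x _.
  under eq_integral => u _ do rewrite dot_cons -addrA.
  rewrite circle_cos; over.
rewrite /=; case: (m == 0) => /=; last by rewrite integral0.
under eq_integral do rewrite EFinM.
rewrite integralZl //; last first.
  apply: (@bounded_integrable _ _ _ _ _ 1); last by move=> x; exact: cos_max.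
  by apply: measurable_cosD; exact: measurable_dot.
by rewrite IH -EFinM; case: ifP; rewrite ?mulr0 // exprS mulrA.
Qed.

Lemma torus_measureT d : torus_measure R d setT = ((2 * pi) ^+ d)%:E.
Proof.
have := torus_cos [tuple of nseq d 0%R] 0; rewrite /= all_nseq /= eqxx orbT cos0 mulr1 => <-.
rewrite -[LHS]mul1e -integral_cst //; apply: eq_integral => x _.
rewrite /dot big1 ?addr0 ?cos0 // => j _.
by rewrite (tnth_nth 0) nth_nseq if_same mul0r.
Qed.

(** The torus identifies 0 and 2 pi while the closed cube keeps both; off the boundary, which is
    null, the two pictures agree. *)
Definition torus_interior d : set (pt d) := [set x | forall j, 0 < tnth x j < 2 * pi].

Lemma measurable_torus_interior d : measurable (@torus_interior d).
Proof.
have -> : @torus_interior d =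
    \bigcap_(j in [set: 'I_d]) ((fun x : pt d => tnth x j) @^-1` `]0, 2 * pi[%classic).
  apply/seteqP; split=> x /=; first by move=> h j _; rewrite /= in_itv /=.
  by move=> h j; have := h j I; rewrite /= in_itv.
apply: fin_bigcap_measurable => // j _; rewrite -[X in measurable X]setTI.
by apply: measurable_tnth => //; exact: measurable_itv.
Qed.

Lemma torus_interiorC d : torus_measure R d (~` @torus_interior d) = 0%E.
Proof.
elim: d => [|d IH].
  rewrite (_ : ~` _ = set0) ?measure0 // -subset0 => x; apply.
  by case.
pose nu := (@circle_measure R \x torus_measure R d)%E.
rewrite -[LHS]/(nu (@tc d @^-1` (~` @torus_interior d.+1))).
pose I := `]0, 2 * pi[%classic : set (measurableTypeR R).
have mI : measurable I by exact: measurable_itv.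
have mK := @measurable_torus_interior d.
have I0 : @circle_measure R (~` I) = 0%E.
  rewrite /circle_measure /mrestr.
  rewrite (_ : ~` I `&` _ = [set 0] `|` [set 2 * pi]); last first.
    apply/seteqP; split=> x; rewrite /I /= !in_itv /=.
      move=> [/negP + /andP[x0 x2]]; rewrite negb_and -!leNgt => /orP[h|h].
        by left; apply/eqP; rewrite eq_le x0 h.
      by right; apply/eqP; rewrite eq_le x2 h.
    by move=> [->|->]; rewrite ltxx ?andbF lexx ltW ?pi2_gt0.
  by apply: null_set_setU; do ?[exact: measurable_set1 | exact: lebesgue_measure_set1].
apply: (@subset_measure0 _ _ _ _ _ (((~` I) `*` setT) `|` (setT `*` (~` @torus_interior d)))).
- rewrite -[X in measurable X]setTI; apply: measurable_tc => //.
  by apply: measurableC; exact: measurable_torus_interior.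
- by apply: measurableU; apply: measurableX => //; exact: measurableC.
- move=> [t x] /= h; have [It|nIt] := pselect (I t); last by left.
  right; split=> // Kx; apply: h => j.
  have [j' ->|->] := unliftP ord0 j; first by rewrite tnthS.
  by rewrite tnth0; move: It; rewrite /I /= in_itv.
apply: null_set_setU.
- by apply: measurableX => //; exact: measurableC.
- by apply: measurableX => //; exact: measurableC.
- by rewrite [LHS]product_measure1E //; [rewrite [X in (X * _)%E]I0 mul0e|exact: measurableC].
- by rewrite [LHS]product_measure1E //; [rewrite [X in (_ * X)%E]IH mule0|exact: measurableC].
Qed.

End torus_integration.

Local Open Scope complex_scope.
(** * Fourier coefficients and Bessel's identity *)

Section fourier_coefficients.
Variables (R : realType) (d : nat).
Local Notation pt := (d.-tuple (measurableTypeR R)).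
Local Notation mu := (torus_measure R d).
Local Notation Re := complex.Re.
Local Notation Im := complex.Im.
Local Notation normc := ComplexField.Normc.normc.
Implicit Types (f g : pt -> R[i]) (z a : R[i]) (k m : d.-tuple int).

(** Free of square roots, so that identities become polynomial in the real and imaginary parts. *)
Definition sqmod (z : R[i]) : R := Re z ^+ 2 + Im z ^+ 2.

Lemma sqr_normcE z : normc z ^+ 2 = sqmod z.
Proof. by case: z => x y; rewrite sqr_sqrtr ?addr_ge0 ?sqr_ge0. Qed.

Lemma sqmod_ge0 z : 0 <= sqmod z.
Proof. by rewrite addr_ge0 ?sqr_ge0. Qed.

Lemma sqmodM z a : sqmod (z * a) = sqmod z * sqmod a.
Proof. by case: z a => x y [u v]; rewrite /sqmod /=; ring. Qed.

Lemma sqmodD z a : sqmod (z + a) <= 2 * sqmod z + 2 * sqmod a.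
Proof.
case: z a => x y [u v]; rewrite /sqmod /=.
by have := sqr_ge0 (x - u); have := sqr_ge0 (y - v); nra.
Qed.

Lemma ReD z a : Re (z + a) = Re z + Re a. Proof. by case: z a => x y []. Qed.
Lemma ImD z a : Im (z + a) = Im z + Im a. Proof. by case: z a => x y []. Qed.
Lemma ReM z a : Re (z * a) = Re z * Re a - Im z * Im a. Proof. by case: z a => x y []. Qed.
Lemma ImM z a : Im (z * a) = Re z * Im a + Im z * Re a. Proof. by case: z a => x y []. Qed.
Lemma complex_eqP z a : Re z = Re a -> Im z = Im a -> z = a.
Proof. by case: z a => x y [u v] /= -> ->. Qed.

Definition rintegrable (g : pt -> R) := mu.-integrable setT (EFin \o g).

Lemma rintegrableD (g h : pt -> R) : rintegrable g -> rintegrable h -> rintegrable (fun x => g x + h x).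
Proof. by move=> ig ih; apply: eq_integrable (integrableD _ ig ih). Qed.

Lemma rintegrableZ (c : R) (g : pt -> R) : rintegrable g -> rintegrable (fun x => c * g x).
Proof. by move=> ig; apply: eq_integrable (integrableZl _ c ig). Qed.

Lemma le_rintegrable (g h : pt -> R) : measurable_fun setT (g : pt -> measurableTypeR R) ->
  (forall x, `|g x| <= h x) -> rintegrable h -> rintegrable g.
Proof.
move=> mg gh; apply: le_integrable => //; first exact/measurable_EFinP.
by move=> x _; rewrite /= lee_fin (le_trans (gh x)) // ler_norm.
Qed.

Definition cintegrable f := rintegrable (fun x => Re (f x)) /\ rintegrable (fun x => Im (f x)).

Lemma complex_integral_lin a f g : cintegrable f -> cintegrable g ->
  complex_integral (fun x => a * f x + g x) = a * complex_integral f + complex_integral g.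
Proof.
move=> [rf jf] [rg jg]; apply: complex_eqP => /=.
  rewrite ReD ReM /= -!RintegralZl // -RintegralB //; [|exact: rintegrableZ|exact: rintegrableZ].
  rewrite -RintegralD //; last first.
    by apply: eq_integrable (rintegrableD (rintegrableZ (Re a) rf) (rintegrableZ (- Im a) jf)) => // x _ /=; rewrite mulNr.
  by apply: eq_Rintegral => x _; rewrite ReD ReM.
rewrite ImD ImM /= -!RintegralZl // -RintegralD //; [|exact: rintegrableZ|exact: rintegrableZ].
rewrite -RintegralD //; last by apply: rintegrableD; exact: rintegrableZ.
by apply: eq_Rintegral => x _; rewrite ImD ImM.
Qed.

Lemma L2_normE f : L2_norm f = ((\int[mu]_x (sqmod (f x))%:E) `^ 2^-1)%E.
Proof.
rewrite /L2_norm unlock; congr (_ `^ _)%E; apply: eq_integral => x _.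
by rewrite /= ger0_norm ?powR_mulrn ?sqr_normcE //; case: (f x) => u v; exact: sqrtr_ge0.
Qed.

Lemma L2P f : L2_space d f <->
  [/\ measurable_fun setT (fun x => Re (f x) : measurableTypeR R),
      measurable_fun setT (fun x => Im (f x) : measurableTypeR R) &
      rintegrable (fun x => sqmod (f x))].
Proof.
have h : (\int[mu]_x `|(sqmod (f x))%:E| = \int[mu]_x (sqmod (f x))%:E)%E.
  by apply: eq_integral => x _; rewrite gee0_abs // lee_fin sqmod_ge0.
rewrite /L2_space /= L2_normE; split=> -[mr mi].
  move=> foo; split=> //; apply/integrableP; split.
    by apply/measurable_EFinP; apply: measurable_funD; exact: measurable_funX.
  by rewrite /= h; apply: lty_poweRy foo; rewrite invr_eq0.
move=> /integrableP[_]; rewrite /= h => foo; split=> //.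
by rewrite poweR_lty.
Qed.

(** The real and imaginary parts are bounded by 1 + |f|^2, and constants are integrable for a finite
    measure. *)
Lemma L2_cintegrable f : L2_space d f -> cintegrable f.
Proof.
move=> /L2P[mr mi i2].
have i3 : rintegrable (fun x => 1 + sqmod (f x)).
  by apply: rintegrableD => //; exact: finite_measure_integrable_cst.
split; apply: le_rintegrable i3 => // x.
  rewrite ler_norml /sqmod; apply/andP.
  by split; have := sqr_ge0 (Re (f x)); have := sqr_ge0 (Im (f x)); nra.
rewrite ler_norml /sqmod; apply/andP.
by split; have := sqr_ge0 (Re (f x)); have := sqr_ge0 (Im (f x)); nra.
Qed.

Lemma L2D f g : L2_space d f -> L2_space d g -> L2_space d (fun x => f x + g x).
Proof.
move=> /L2P[mr mi i2] /L2P[mr' mi' i2'].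
have mr'' : measurable_fun setT (fun x => Re (f x + g x) : measurableTypeR R).
  by under eq_fun do rewrite ReD; exact: measurable_funD.
have mi'' : measurable_fun setT (fun x => Im (f x + g x) : measurableTypeR R).
  by under eq_fun do rewrite ImD; exact: measurable_funD.
apply/L2P; split=> //.
apply: le_rintegrable (rintegrableD (rintegrableZ 2 i2) (rintegrableZ 2 i2')) => //.
  by apply: measurable_funD; exact: measurable_funX.
by move=> x; rewrite ger0_norm ?sqmod_ge0 // sqmodD.
Qed.

Lemma bounded_measurableM f g (C : R) : (forall x, sqmod (g x) <= C) ->
  measurable_fun setT (fun x => Re (g x) : measurableTypeR R) ->
  measurable_fun setT (fun x => Im (g x) : measurableTypeR R) ->
  L2_space d f -> L2_space d (fun x => f x * g x).
Proof.
move=> gC mr' mi' /L2P[mr mi i2].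
have mr'' : measurable_fun setT (fun x => Re (f x * g x) : measurableTypeR R).
  by under eq_fun do rewrite ReM; apply: measurable_funB; exact: measurable_funM.
have mi'' : measurable_fun setT (fun x => Im (f x * g x) : measurableTypeR R).
  by under eq_fun do rewrite ImM; apply: measurable_funD; exact: measurable_funM.
apply/L2P; split=> //; apply: le_rintegrable (rintegrableZ C i2) => //.
  by apply: measurable_funD; exact: measurable_funX.
by move=> x; rewrite ger0_norm ?sqmod_ge0 // sqmodM mulrC ler_wpM2r ?sqmod_ge0.
Qed.

Lemma L2_cst a : L2_space d (fun=> a).
Proof.
by apply/L2P; split=> //; exact: finite_measure_integrable_cst.
Qed.

Lemma L2Z a f : L2_space d f -> L2_space d (fun x => a * f x).
Proof.
move=> fL; under eq_fun do rewrite mulrC.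
exact: (@bounded_measurableM f (fun=> a) (sqmod a) (fun=> lexx _)).
Qed.

Lemma L2N f : L2_space d f -> L2_space d (fun x => - f x).
Proof. by move=> /(L2Z (-1)); under eq_fun do rewrite mulN1r. Qed.

Lemma L2B f g : L2_space d f -> L2_space d g -> L2_space d (fun x => f x - g x).
Proof. by move=> fL /L2N; exact: L2D. Qed.

Lemma expiD (s t : R) : expi (s + t) = expi s * expi t.
Proof. by apply: complex_eqP; rewrite /= ?cosD ?sinD // addrC [X in X + _]mulrC [X in _ + X]mulrC. Qed.

Lemma sqmod_expi (t : R) : sqmod (expi t) = 1.
Proof. exact: cos2Dsin2. Qed.

Lemma measurable_expi (g : pt -> measurableTypeR R) : measurable_fun setT g ->
  measurable_fun setT (fun x => Re (expi (g x)) : measurableTypeR R) /\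
  measurable_fun setT (fun x => Im (expi (g x)) : measurableTypeR R).
Proof.
move=> mg; split.
  apply: (@measurableT_comp _ _ _ _ _ _ (@cos R)) => //.
  by apply: continuous_measurable_fun; exact: continuous_cos.
apply: (@measurableT_comp _ _ _ _ _ _ (@sin R)) => //.
by apply: continuous_measurable_fun; exact: continuous_sin.
Qed.

Lemma L2_expiM f (g : pt -> measurableTypeR R) : measurable_fun setT g ->
  L2_space d f -> L2_space d (fun x => f x * expi (g x)).
Proof.
move=> /measurable_expi[mr mi]; apply: (@bounded_measurableM _ _ 1) => // x.
by rewrite sqmod_expi.
Qed.

Definition fourier_scale : R := (2 * pi) `^ (- (d%:R / 2)).

Lemma sqr_fourier_scale : fourier_scale ^+ 2 * (2 * pi) ^+ d = 1.
Proof.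
rewrite /fourier_scale -powR_mulrn ?powR_ge0 // -powRrM.
have -> : - (d%:R / 2) * 2%:R = - d%:R :> R by field.
by rewrite powRN powR_mulrn ?ltW ?pi2_gt0 // mulVf // expf_neq0 // gt_eqF ?pi2_gt0.
Qed.

Definition mode k (x : pt) : R[i] := fourier_scale%:C * expi (dot k x).

Lemma sqmod_mode k x : sqmod (mode k x) = fourier_scale ^+ 2.
Proof. by rewrite sqmodM sqmod_expi mulr1 /sqmod /= expr0n addr0. Qed.

Lemma L2_mode k : L2_space d (mode k).
Proof. by apply: L2_expiM; [exact: measurable_dot|exact: L2_cst]. Qed.

Lemma fourier_coefE k f :
  fourier_coef k f = fourier_scale%:C * complex_integral (fun x => f x * expi (- dot k x)).
Proof. by []. Qed.

Lemma measurable_dotN k : measurable_fun setT (fun x : pt => - dot k x : measurableTypeR R).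
Proof. by apply: measurableT_comp => //; exact: measurable_dot. Qed.

Lemma fourier_coef_lin k a f g : L2_space d f -> L2_space d g ->
  fourier_coef k (fun x => a * f x + g x) = a * fourier_coef k f + fourier_coef k g.
Proof.
move=> fL gL; rewrite !fourier_coefE mulrCA -mulrDr -complex_integral_lin.
- by congr (_ * complex_integral _); apply/funext => x; rewrite mulrDl mulrA.
- by apply: L2_cintegrable; apply: L2_expiM fL; exact: measurable_dotN.
- by apply: L2_cintegrable; apply: L2_expiM gL; exact: measurable_dotN.
Qed.

End fourier_coefficients.

Section bessel.
Variables (R : realType) (d : nat).
Local Notation pt := (d.-tuple (measurableTypeR R)).
Local Notation mu := (torus_measure R d).
Local Notation Re := complex.Re.
Local Notation Im := complex.Im.
Implicit Types (f g p q : pt -> R[i]) (z a : R[i]) (k m : d.-tuple int) (l : seq (d.-tuple int)).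

Definition freqD k m : d.-tuple int := [tuple (tnth k j + tnth m j)%R | j < d].
Definition freqB k m : d.-tuple int := [tuple (tnth k j - tnth m j)%R | j < d].

Lemma dotD k m (x : pt) : dot (freqD k m) x = dot k x + dot m x.
Proof.
by rewrite /dot -big_split /=; apply: eq_bigr => j _; rewrite tnth_mktuple rmorphD /= mulrDl.
Qed.

Lemma dotB k m (x : pt) : dot (freqB k m) x = dot k x - dot m x.
Proof.
by rewrite /dot -sumrB; apply: eq_bigr => j _; rewrite tnth_mktuple rmorphB /= mulrBl.
Qed.

Lemma freqB_eq0 k m : all (pred1 0%R) (freqB k m) = (k == m).
Proof.
apply/allP/eqP => [h|->]; last first.
  by move=> x /mapP[j _ ->]; rewrite /= subrr.
apply: eq_from_tnth => j; apply/eqP; rewrite -subr_eq0.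
by apply: h; rewrite -(tnth_mktuple (fun j => tnth k j - tnth m j)%R j) mem_tnth.
Qed.

Lemma complex_integral_expi k : complex_integral (fun x : pt => expi (dot k x)) =
  (if all (pred1 0%R) k then (2 * pi) ^+ d else 0)%:C.
Proof.
apply: complex_eqP; rewrite /= /Rintegral.
  rewrite (eq_integral (fun x : pt => (cos (dot k x + 0))%:E)) => [|x _]; last by rewrite addr0.
  by rewrite torus_cos cos0; case: ifP; rewrite ?mulr1.
rewrite (eq_integral (fun x : pt => (cos (dot k x + - (pi / 2)))%:E)) => [|x _]; last first.
  by rewrite cosBpihalf.
by rewrite torus_cos cosN cos_pihalf mulr0 if_same.
Qed.

Lemma complex_integralZ a f : cintegrable f ->
  complex_integral (fun x => a * f x) = a * complex_integral f.
Proof.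
move=> fi; have i0 : cintegrable (fun _ : pt => 0 : R[i]) by apply: L2_cintegrable; exact: L2_cst.
have c0 : complex_integral (fun _ : pt => 0 : R[i]) = 0.
  by apply: complex_eqP; rewrite /= Rintegral_cst // mul0r.
have := complex_integral_lin a fi i0; rewrite c0 addr0 => <-.
by congr complex_integral; apply/funext => x; rewrite addr0.
Qed.

Lemma fourier_coef_mode k m : fourier_coef k (@mode R d m) = (m == k)%:R.
Proof.
rewrite fourier_coefE.
have -> : (fun x : pt => mode m x * expi (- dot k x)) =
          (fun x => (fourier_scale R d)%:C * expi (dot (freqB m k) x)).
  by apply/funext => x; rewrite /mode -mulrA -expiD dotB.
rewrite complex_integralZ; last first.
  apply: L2_cintegrable; have := L2_expiM (measurable_dot (freqB m k)) (L2_cst d (1 : R[i])).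
  by under eq_fun do rewrite mul1r.
rewrite complex_integral_expi freqB_eq0 mulrA -!rmorphM /= -expr2.
by case: eqP => _; rewrite ?mulr0 ?sqr_fourier_scale.
Qed.

Definition sqnorm f : R := \int[mu]_x sqmod (f x).

Lemma sqnormE f : L2_space d f -> (\int[mu]_x (sqmod (f x))%:E)%E = (sqnorm f)%:E.
Proof. by move=> /L2P[_ _ fi]; rewrite /sqnorm /Rintegral fineK // integrable_fin_num. Qed.

Lemma sqnorm_ge0 f : 0 <= sqnorm f.
Proof. by apply: Rintegral_ge0 => x _; exact: sqmod_ge0. Qed.

Lemma sqnormD f g : L2_space d f -> L2_space d g -> sqnorm (fun x => f x + g x) <= 2 * sqnorm f + 2 * sqnorm g.
Proof.
move=> fL gL; have /L2P[_ _ si] := L2D fL gL.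
move: fL gL => /L2P[_ _ fi] /L2P[_ _ gi].
rewrite /sqnorm -!RintegralZl // -RintegralD //; [|exact: rintegrableZ|exact: rintegrableZ].
by apply: le_Rintegral => //; [apply: rintegrableD; exact: rintegrableZ|move=> x _; exact: sqmodD].
Qed.

Lemma sqnormZ a f : L2_space d f -> sqnorm (fun x => a * f x) = sqmod a * sqnorm f.
Proof.
move=> /L2P[_ _ fi]; rewrite /sqnorm -RintegralZl //.
by apply: eq_Rintegral => x _; rewrite sqmodM.
Qed.

(** Completing the square in a. Keeping a arbitrary yields both the norm of a trigonometric
    polynomial and the optimality of the Fourier coefficients. *)
Lemma sqnorm_sub_mode f a k : L2_space d f ->
  sqnorm (fun x => f x - a * mode k x) =
  sqnorm f - sqmod (fourier_coef k f) + sqmod (fourier_coef k f - a).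
Proof.
move=> fL; pose h x := f x * expi (- dot k x).
have [rh ih] : cintegrable h by apply: L2_cintegrable; apply: L2_expiM fL; exact: measurable_dotN.
have /L2P[_ _ fi] := fL.
(* In the expansion of the square, the cross term splits along the real and imaginary parts of [h],
   whose integrals make up the Fourier coefficient. *)
have ptE x : sqmod (f x - a * mode k x) =
    sqmod (f x) + ((- 2 * fourier_scale R d * Re a) * Re (h x) +
    ((- 2 * fourier_scale R d * Im a) * Im (h x) + sqmod a * fourier_scale R d ^+ 2)).
  rewrite -(sqmod_mode k x) -sqmodM /h /mode /expi cosN sinN /sqmod.
  move: (cos _) (sin _) => c s; case: (f x) a => u v [e b] /=; ring.
rewrite {1}/sqnorm (eq_Rintegral _ (fun x _ => ptE x)).
have ic c : rintegrable (fun _ : pt => c : R) by exact: finite_measure_integrable_cst.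
have i1 := rintegrableZ (- 2 * fourier_scale R d * Im a) ih.
have i2 := rintegrableZ (- 2 * fourier_scale R d * Re a) rh.
have i3 := rintegrableD i1 (ic (sqmod a * fourier_scale R d ^+ 2)).
rewrite (RintegralD measurableT fi (rintegrableD i2 i3)) (RintegralD measurableT i2 i3).
have cE : \int[mu]_x (sqmod a * fourier_scale R d ^+ 2) = sqmod a.
  rewrite Rintegral_cst // [X in fine X](_ : _ = ((2 * pi) ^+ d)%:E).
    by rewrite /= -mulrA sqr_fourier_scale mulr1.
  exact: torus_measureT.
rewrite (RintegralD measurableT i1 (ic _)) cE !RintegralZl // -addrA; congr (_ + _).
rewrite fourier_coefE -/h /complex_integral /sqmod.
move: (\int[_]_x Re _) (\int[_]_x Im _) => A B.
by case: a {ptE i1 i2 i3 cE} => e b /=; ring.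
Qed.

Definition trig l (c : d.-tuple int -> R[i]) (x : pt) : R[i] := \sum_(k <- l) c k * mode k x.

Lemma L2_trig l c : L2_space d (trig l c).
Proof.
elim: l => [|k l IH]; rewrite /trig; under eq_fun do rewrite ?big_nil ?big_cons.
  exact: L2_cst.
by apply: L2D => //; apply: L2Z; exact: L2_mode.
Qed.

Lemma fourier_coef0 k : fourier_coef k (fun _ : pt => 0) = 0 :> R[i].
Proof.
have := fourier_coef_lin k (-1) (L2_cst d (0 : R[i])) (L2_cst d (0 : R[i])).
by rewrite mulr0 addr0 mulN1r addNr.
Qed.

Lemma fourier_coef_trig k l c : uniq l ->
  fourier_coef k (trig l c) = if k \in l then c k else 0.
Proof.
elim: l => [|m l IH] /=; rewrite /trig; under eq_fun do rewrite ?big_nil ?big_cons.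
  by rewrite fourier_coef0.
move=> /andP[ml ul]; rewrite fourier_coef_lin; [|exact: L2_mode|exact: L2_trig].
rewrite [X in _ + X]IH // fourier_coef_mode inE eq_sym.
by case: eqP => [->|_] /=; rewrite ?(negPf ml) ?mulr1 ?mulr0 ?addr0 ?add0r.
Qed.

Lemma fourier_coef_sub k f g : L2_space d f -> L2_space d g ->
  fourier_coef k (fun x => f x - g x) = fourier_coef k f - fourier_coef k g.
Proof.
move=> fL gL; have := fourier_coef_lin k (-1) gL fL; rewrite mulN1r addrC => <-.
by congr fourier_coef; apply/funext => x; rewrite mulN1r addrC.
Qed.

(** One mode is peeled off at a time. By orthonormality, subtracting the modes in [l] leaves the
    coefficient at a frequency outside [l] unchanged. *)
Lemma sqnorm_sub_trig f l c : L2_space d f -> uniq l ->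
  sqnorm (fun x => f x - trig l c x) = sqnorm f -
    \sum_(k <- l) (sqmod (fourier_coef k f) - sqmod (fourier_coef k f - c k)).
Proof.
move=> fL; elim: l => [|k l IH] /= => [_|/andP[kl ul]].
  by rewrite big_nil subr0; congr sqnorm; apply/funext => x; rewrite /trig big_nil subr0.
have -> : (fun x => f x - trig (k :: l) c x) =
          (fun x => (f x - trig l c x) - c k * mode k x).
  by apply/funext => x; rewrite /trig big_cons opprD addrAC addrA.
have gL := L2B fL (L2_trig l c).
rewrite sqnorm_sub_mode // fourier_coef_sub //; last exact: L2_trig.
by rewrite fourier_coef_trig // (negPf kl) subr0 IH // big_cons; ring.
Qed.

Lemma sqnorm_trig l c : uniq l -> sqnorm (trig l c) = \sum_(k <- l) sqmod (c k).
Proof.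
move=> ul; have := sqnorm_sub_trig (fun k => - c k) (L2_cst d (0 : R[i])) ul.
have -> : (fun x => 0 - trig l (fun k => - c k) x) = trig l c.
  apply/funext => x; rewrite sub0r /trig -sumrN; apply: eq_bigr => k _.
  by rewrite mulNr opprK.
move=> ->; rewrite {1}/sqnorm Rintegral_cst // {1}/sqmod /= expr0n addr0 mul0r sub0r -sumrN.
apply: eq_bigr => k _; rewrite fourier_coef0 sub0r opprK.
by rewrite {1}/sqmod /= expr0n addr0 sub0r opprK.
Qed.

(** Frequencies may repeat here, which turns closure under sums and products into plain inductions;
    [trig_polyE] afterwards collects equal frequencies. *)
Inductive trig_poly : (pt -> R[i]) -> Prop :=
| trig_poly0 : trig_poly (fun=> 0)
| trig_polyS p a k : trig_poly p -> trig_poly (fun x => p x + a * expi (dot k x)).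

Lemma trig_polyD p q : trig_poly p -> trig_poly q -> trig_poly (fun x => p x + q x).
Proof.
move=> pP; elim=> [|q' a k _ IH]; first by under eq_fun do rewrite addr0.
by under eq_fun do rewrite addrA; constructor.
Qed.

Lemma trig_polyME p a k : trig_poly p -> trig_poly (fun x => p x * (a * expi (dot k x))).
Proof.
elim=> [|q b m _ IH]; first by under eq_fun do rewrite mul0r; constructor.
under eq_fun do rewrite mulrDl mulrACA -expiD -dotD.
by constructor.
Qed.

Lemma trig_polyM p q : trig_poly p -> trig_poly q -> trig_poly (fun x => p x * q x).
Proof.
move=> pP; elim=> [|q' a k _ IH]; first by under eq_fun do rewrite mulr0; constructor.
by under eq_fun do rewrite mulrDr; apply: trig_polyD => //; exact: trig_polyME.
Qed.

Lemma trig_poly_expi a k : trig_poly (fun x => a * expi (dot k x)).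
Proof. by have := trig_polyS a k trig_poly0; under eq_fun do rewrite add0r. Qed.

Lemma trig_poly_cst a : trig_poly (fun=> a).
Proof.
have := trig_poly_expi a [tuple of nseq d 0%R].
rewrite (_ : (fun x => _) = (fun=> a)) //; apply/funext => x.
rewrite /dot big1 /=; last by move=> j _; rewrite (tnth_nth 0) nth_nseq if_same mul0r.
by rewrite /expi cos0 sin0 mulr1.
Qed.

Lemma fourier_scale_neq0 : (fourier_scale R d)%:C != 0.
Proof.
rewrite eq_complex /= negb_and; apply/orP; left.
by rewrite gt_eqF // powR_gt0 // pi2_gt0.
Qed.

Lemma trig_polyE p : trig_poly p -> exists l c, uniq l /\ p = trig l c.
Proof.
elim=> [|q a k _ [l [c [ul ->]]]].
  by exists [::], (fun=> 0); split=> //; apply/funext => x; rewrite /trig big_nil.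
have eE x : a * expi (dot k x) = (a / (fourier_scale R d)%:C) * mode k x.
  by rewrite /mode mulrA divfK // fourier_scale_neq0.
have [kl|kl] := boolP (k \in l); last first.
  exists (k :: l), (fun m => if m == k then a / (fourier_scale R d)%:C else c m).
  split; first by rewrite /= kl.
  apply/funext => x; rewrite /trig big_cons eqxx -eE addrC; congr (_ + _).
  rewrite big_seq [RHS]big_seq; apply: eq_bigr => m ml.
  by case: eqP => // mk; rewrite -mk ml in kl.
exists l, (fun m => if m == k then c k + a / (fourier_scale R d)%:C else c m); split=> //.
apply/funext => x; rewrite /trig (bigD1_seq k) //= [RHS](bigD1_seq k) //= eqxx.
rewrite mulrDl -eE addrAC; congr (_ + _).
by apply: eq_bigr => m /negPf ->.
Qed.

Lemma L2_trig_poly p : trig_poly p -> L2_space d p.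
Proof. by move=> /trig_polyE[l [c [_ ->]]]; exact: L2_trig. Qed.

End bessel.

(** * Completeness of the trigonometric system *)

Section step_polynomial.
Variable R : realType.

(* On [0, 1], [(1 - u ^ n) ^ N] drops from about 1 to about 0 where
   [N * u ^ n] is about 1; with [N = n * 2 ^ n] this happens at [u = 1 / 2], and
   the factor [n] forces the limit 0 at [u = 1 / 2] itself. *)
Definition step_poly (n : nat) (u : R) : R := (1 - u ^+ n) ^+ (n * 2 ^ n).

Lemma bernoulli (v : R) (N : nat) : -1 <= v -> 1 + N%:R * v <= (1 + v) ^+ N.
Proof.
move=> v1; elim: N => [|N IH]; first by rewrite mul0r addr0 expr0.
rewrite exprS; apply: le_trans (ler_wpM2l _ IH); last by lra.
rewrite -natr1; have : 0 <= N%:R * (v * v) :> R by rewrite mulr_ge0 // -expr2 sqr_ge0.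
lra.
Qed.

Lemma step_poly_itv (n : nat) (u : R) : 0 <= u <= 1 -> 0 <= step_poly n u <= 1.
Proof.
move=> /andP[u0 u1]; have /andP[v0 v1] : 0 <= 1 - u ^+ n <= 1.
  by rewrite subr_ge0 exprn_ile1 // gerBl exprn_ge0.
by rewrite exprn_ge0 // exprn_ile1.
Qed.

(** With q = r^2, Bernoulli's inequality for (1 / r)^n bounds n r^n by a constant, and a factor r^n
    remains. *)
Lemma cvg_nMgeometric (q : R) : 0 <= q < 1 -> n%:R * q ^+ n @[n --> \oo] --> (0 : R).
Proof.
move=> /andP[q0 q1].
have [->|qn0] := eqVneq q 0.
  apply: cvg_near_cst; near=> n.
  have n0 : (0 < n)%N by near: n; exact: nbhs_infty_gt.
  by rewrite expr0n gtn_eqF // mulr0.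
have q0' : 0 < q by rewrite lt0r qn0.
pose r := Num.sqrt q; have r0 : 0 < r by rewrite sqrtr_gt0.
have rE : q = r * r by rewrite -expr2 sqr_sqrtr.
have r1 : r < 1 by nra.
have e0 : 0 < r^-1 - 1 by rewrite subr_gt0 invf_gt1.
have h n : n%:R * q ^+ n <= (r^-1 - 1)^-1 * r ^+ n.
  rewrite rE exprMn mulrA ler_wpM2r ?exprn_ge0 ?(ltW r0) //.
  have b : 1 + n%:R * (r^-1 - 1) <= (1 + (r^-1 - 1)) ^+ n by apply: bernoulli; lra.
  rewrite (_ : 1 + (r^-1 - 1) = r^-1) ?exprVn in b; last by lra.
  rewrite -(ler_pM2r e0) mulVf ?gt_eqF // mulrAC -ler_pdivlMr ?exprn_gt0 // mul1r; lra.
apply: (@squeeze_cvgr _ _ _ _ (fun=> 0) (fun n => (r^-1 - 1)^-1 * r ^+ n)).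
- by near=> n; rewrite h mulr_ge0 // exprn_ge0.
- exact: cvg_cst.
- rewrite -[X in _ --> X](mulr0 (r^-1 - 1)^-1); apply: cvgMr; apply: cvg_expr.
  by rewrite ger0_norm // ltW.
Unshelve. all: by end_near. Qed.

(** Bernoulli's inequality on both sides of 1 / 2. Put v = u^n and N = n 2^n, so that N v = n (2
    u)^n. Below 1 / 2, (1 - v)^N >= 1 - N v tends to 1. From 1 / 2 on, (1 - v)^N (1 + v)^N <= 1 and
    (1 + v)^N >= 1 + N v >= n + 1. *)
Lemma cvg_step_poly (u : R) : 0 <= u <= 1 ->
  step_poly n u @[n --> \oo] --> ((u < 2^-1)%R%:R : R).
Proof.
move=> u01; have /andP[u0 u1] := u01.
have NvE n : (n * 2 ^ n)%:R * u ^+ n = n%:R * (2 * u) ^+ n :> R.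
  by rewrite natrM natrX exprMn mulrA.
have un0 n : 0 <= u ^+ n by rewrite exprn_ge0.
have un1 n : u ^+ n <= 1 by rewrite exprn_ile1.
case: ltP => uh /=.
  apply: (@squeeze_cvgr _ _ _ _ (fun n => 1 - n%:R * (2 * u) ^+ n) (fun=> 1)).
  - near=> n; have /andP[_ ->] := step_poly_itv n u01; rewrite andbT -NvE -mulrN.
    by apply: bernoulli; rewrite lerN2.
  - rewrite -[X in _ --> X]subr0; apply: cvgB; first exact: cvg_cst.
    by apply: cvg_nMgeometric; lra.
  - exact: cvg_cst.
apply: (@squeeze_cvgr _ _ _ _ (fun=> 0) (fun n => n.+1%:R^-1)).
- near=> n; have /andP[-> _] := step_poly_itv n u01; rewrite /=.
  set N := (n * 2 ^ n)%N; set v := u ^+ n.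
  have h1 : (1 - v) ^+ N * (1 + v) ^+ N <= 1.
    rewrite -exprMn exprn_ile1 //.
      by rewrite mulr_ge0 ?subr_ge0 ?un1 // addr_ge0 // un0.
    have := sqr_ge0 v; rewrite /v; nra.
  have h2 : n.+1%:R <= (1 + v) ^+ N.
    apply: le_trans (bernoulli _ _); last by rewrite (le_trans _ (un0 n)) // lerN10.
    rewrite NvE -natr1 addrC lerD2l ler_peMr // exprn_ege1 //; lra.
  have n0 : 0 < n.+1%:R :> R by [].
  rewrite -[leRHS]mul1r ler_pdivlMr //; apply: le_trans h1.
  by rewrite ler_wpM2l // exprn_ge0 // subr_ge0 un1.
- exact: cvg_cst.
- exact: cvg_harmonic.
Unshelve. all: by end_near. Qed.

End step_polynomial.

Section density.
Variables (R : realType) (d : nat).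
Local Notation pt := (d.-tuple (measurableTypeR R)).
Local Notation mu := (torus_measure R d).
Local Notation Re := complex.Re.
Local Notation Im := complex.Im.
Implicit Types (f g p q : pt -> R[i]) (z a : R[i]) (k m : d.-tuple int).

Definition trig_closure f := L2_space d f /\
  forall e : R, 0 < e -> exists2 p, trig_poly p & sqnorm (fun x => f x - p x) <= e.

Lemma trig_closure_poly p : trig_poly p -> trig_closure p.
Proof.
move=> pP; split; first exact: L2_trig_poly.
move=> e e0; exists p => //; rewrite (_ : (fun x => _) = fun=> 0).
  by rewrite /sqnorm Rintegral_cst // /sqmod /= expr0n addr0 mul0r ltW.
by apply/funext => x; rewrite subrr.
Qed.

Lemma trig_closure_approx f : L2_space d f ->
  (forall e : R, 0 < e -> exists2 g, trig_closure g & sqnorm (fun x => f x - g x) <= e) ->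
  trig_closure f.
Proof.
move=> fL fg; split=> // e e0; have e4 : 0 < e / 4 by rewrite divr_gt0.
have [g [gL gp] fge] := fg _ e4; have [p pP gpe] := gp _ e4.
exists p => //; have pL := L2_trig_poly pP.
have -> : (fun x => f x - p x) = (fun x => (f x - g x) + (g x - p x)).
  by apply/funext => x; rewrite addrA subrK.
apply: le_trans (sqnormD (L2B fL gL) (L2B gL pL)) _; lra.
Qed.

Lemma trig_closureD f g : trig_closure f -> trig_closure g -> trig_closure (fun x => f x + g x).
Proof.
move=> [fL fp] [gL gp]; split; first exact: L2D.
move=> e e0; have e4 : 0 < e / 4 by rewrite divr_gt0.
have [p pP fpe] := fp _ e4; have [q qP gqe] := gp _ e4.
exists (fun x => p x + q x); first exact: trig_polyD.
have -> : (fun x => f x + g x - (p x + q x)) = (fun x => (f x - p x) + (g x - q x)).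
  by apply/funext => x; rewrite opprD addrACA.
have pL := L2_trig_poly pP; have qL := L2_trig_poly qP.
apply: le_trans (sqnormD (L2B fL pL) (L2B gL qL)) _; lra.
Qed.

Lemma trig_closureZ a f : trig_closure f -> trig_closure (fun x => a * f x).
Proof.
move=> [fL fp]; split; first exact: L2Z.
move=> e e0; have a1 : 0 < sqmod a + 1 by rewrite ltr_wpDl ?sqmod_ge0.
have [p pP fpe] := fp _ (divr_gt0 e0 a1); have pL := L2_trig_poly pP.
exists (fun x => a * p x); first exact: trig_polyM (trig_poly_cst d a) pP.
have -> : (fun x => a * f x - a * p x) = (fun x => a * (f x - p x)).
  by apply/funext => x; rewrite mulrBr.
rewrite (sqnormZ _ (L2B fL pL)); move: fpe; rewrite ler_pdivlMr //.
by have := sqnorm_ge0 (fun x => f x - p x); lra.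
Qed.

Lemma trig_closureB f g : trig_closure f -> trig_closure g -> trig_closure (fun x => f x - g x).
Proof.
move=> fc /(trig_closureZ (-1)) /(trig_closureD fc).
by under eq_fun do rewrite mulN1r.
Qed.

(** By dominated convergence the squared distances tend to 0 in the mean, so some [F n] is close to
    [f]. *)
Lemma trig_closure_lim f (F : nat -> pt -> R[i]) (G : pt -> R) : L2_space d f ->
  (forall n, trig_closure (F n)) -> rintegrable G ->
  (forall n x, sqmod (f x - F n x) <= G x) ->
  {ae mu, forall x, sqmod (f x - F n x) @[n --> \oo] --> (0 : R)} ->
  trig_closure f.
Proof.
move=> fL FV iG FG cF; apply: trig_closure_approx => // e e0.
have sL n : L2_space d (fun x => f x - F n x) by apply: L2B => //; case: (FV n).
have ms n : measurable_fun setT (EFin \o (fun x => sqmod (f x - F n x))).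
  by have /L2P[_ _] := sL n; exact: measurable_int.
have [||||_ _] := @dominated_convergence _ _ _ mu setT measurableT
  (fun n => EFin \o (fun x => sqmod (f x - F n x))) (cst 0%E) (EFin \o G) ms.
- exact: measurable_cst.
- by apply: filterS cF => x cx _; apply: cvg_EFin => //; near=> n.
- exact: iG.
- by apply: aeW => x n _; rewrite /= lee_fin ger0_norm ?sqmod_ge0.
rewrite integral0 /=.
under eq_fun do rewrite (sqnormE (sL _)).
move=> /fine_cvgP[_ /cvgrPdist_le /(_ _ e0)] [N _ /(_ N (leqnn N))] /=.
rewrite sub0r normrN ger0_norm ?sqnorm_ge0 // => hN.
by exists (F N).
Unshelve. all: by end_near. Qed.

End density.

Section sine_sign.
Variable R : realType.

Lemma sin_gt0E (s : R) : - pi < s < pi -> (0 < sin s) = (0 < s).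
Proof.
move=> /andP[s1 s2]; case: (ltP 0 s) => s0; first by rewrite sin_gt0_pi ?s0.
apply/negbTE; rewrite -leNgt -oppr_ge0 -sinN sin_ge0_pi //; lra.
Qed.

Lemma sin_gt0_period (t : R) : 0 < t < 2 * pi -> (0 < sin t) = (t < pi).
Proof.
move=> t02; have -> : sin t = sin (pi - t) by rewrite addrC sinDpi sinN opprK.
by rewrite sin_gt0E ?subr_gt0 //; lra.
Qed.

Lemma sin_lt0_period (t : R) : 0 < t < 2 * pi -> (0 < - sin t) = (pi < t).
Proof.
move=> t02; have -> : - sin t = sin (t - pi).
  by rewrite -[in LHS](subrK pi t) sinDpi opprK.
by rewrite sin_gt0E ?subr_gt0 //; lra.
Qed.

End sine_sign.

(** * Approximation of indicators of measurable sets *)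

Section pi_lambda.
Variables (R : realType) (d : nat).
Local Notation pt := (d.-tuple (measurableTypeR R)).
Local Notation mu := (torus_measure R d).
Local Notation Re := complex.Re.
Local Notation Im := complex.Im.
Implicit Types (f g p q : pt -> R[i]) (z a : R[i]) (k m : d.-tuple int) (E F : set pt).

Definition real_trig_poly (P : pt -> R) := trig_poly (fun x => (P x)%:C).

Lemma real_trig_poly_cst (c : R) : real_trig_poly (fun=> c).
Proof. exact: trig_poly_cst. Qed.

Lemma real_trig_polyM (P Q : pt -> R) :
  real_trig_poly P -> real_trig_poly Q -> real_trig_poly (fun x => P x * Q x).
Proof.
move=> hP hQ; rewrite /real_trig_poly; under eq_fun do rewrite rmorphM /=.
exact: trig_polyM.
Qed.

Lemma real_trig_polyD (P Q : pt -> R) :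
  real_trig_poly P -> real_trig_poly Q -> real_trig_poly (fun x => P x + Q x).
Proof.
move=> hP hQ; rewrite /real_trig_poly; under eq_fun do rewrite rmorphD /=.
exact: trig_polyD.
Qed.

Lemma real_trig_polyB (P Q : pt -> R) :
  real_trig_poly P -> real_trig_poly Q -> real_trig_poly (fun x => P x - Q x).
Proof.
move=> hP hQ; under eq_fun do rewrite -[Q _]mul1r -mulNr.
by apply: real_trig_polyD => //; apply: real_trig_polyM => //; exact: real_trig_poly_cst.
Qed.

Lemma real_trig_polyX (P : pt -> R) n : real_trig_poly P -> real_trig_poly (fun x => P x ^+ n).
Proof.
move=> hP; elim: n => [|n IH]; first exact: real_trig_poly_cst.
by under eq_fun do rewrite exprS; exact: real_trig_polyM.
Qed.

Lemma real_trig_poly_cos (j : 'I_d) (y : R) :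
  real_trig_poly (fun x => cos (tnth x j - y)).
Proof.
pose u (s : int) : d.-tuple int := [tuple (if i == j then s else 0)%R | i < d].
have uE s (x : pt) : dot (u s) x = s%:~R * tnth x j.
  rewrite /dot (bigD1 j) //= tnth_mktuple eqxx big1 ?addr0 // => i /negPf ij.
  by rewrite tnth_mktuple ij mul0r.
have := trig_polyD (trig_poly_expi ((2^-1)%:C * expi (- y)) (u 1))
                   (trig_poly_expi ((2^-1)%:C * expi y) (u (-1))).
rewrite /real_trig_poly; congr trig_poly; apply/funext => x.
rewrite -!mulrA -!expiD !uE mulrNz mulNr mul1r.
have -> : - y + tnth x j = tnth x j - y by rewrite addrC.
have -> : y - tnth x j = - (tnth x j - y) by rewrite opprB.
set t := tnth x j - y; apply: complex_eqP => /=; first by rewrite cosN; field.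
by rewrite sinN; field.
Qed.

(* The convergence is only required on the open cube, which has full measure:
   trigonometric polynomials cannot separate 0 from [2 * pi]. *)
Definition trig_limit_set : set (set pt) := [set E | measurable E /\
  exists P : nat -> pt -> R, [/\ forall n, real_trig_poly (P n),
    forall n x, 0 <= P n x <= 1 &
    forall x, torus_interior x -> P n x @[n --> \oo] --> (\1_E x : R)]].

Lemma trig_limit_setC E : trig_limit_set E -> trig_limit_set (~` E).
Proof.
move=> [mE [P [Pt P01 Pc]]]; split; first exact: measurableC.
exists (fun n x => 1 - P n x); split.
- by move=> n; apply: real_trig_polyB => //; exact: real_trig_poly_cst.
- by move=> n x; have := P01 n x; lra.
- move=> x xi; rewrite indicE in_setC; have := Pc x xi; rewrite indicE => h.
  rewrite (_ : (~~ (x \in E))%:R = 1 - (x \in E)%:R); last by case: (x \in E); rewrite ?subrr ?subr0.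
  by apply: cvgB => //; exact: cvg_cst.
Qed.

Lemma trig_limit_setI : setI_closed trig_limit_set.
Proof.
move=> E F [mE [P [Pt P01 Pc]]] [mF [Q [Qt Q01 Qc]]]; split; first exact: measurableI.
exists (fun n x => P n x * Q n x); split.
- by move=> n; exact: real_trig_polyM.
- move=> n x; have /andP[p0 p1] := P01 n x; have /andP[q0 q1] := Q01 n x.
  by rewrite mulr_ge0 // mulr_ile1.
- by move=> x xi; rewrite indicI; apply: cvgM; [exact: Pc|exact: Qc].
Qed.

Lemma trig_limit_setT : trig_limit_set setT.
Proof.
split=> //; exists (fun _ _ => 1); split.
- by move=> n; exact: real_trig_poly_cst.
- by move=> n x; rewrite ler01 lexx.
- by move=> x _; rewrite indicT; exact: cvg_cst.
Qed.

Lemma trig_limit_set_congr E F : measurable E -> trig_limit_set F ->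
  (forall x, torus_interior x -> E x <-> F x) -> trig_limit_set E.
Proof.
move=> mE [mF [P [Pt P01 Pc]]] EF; split=> //; exists P; split=> // x xi.
rewrite (_ : \1_E x = \1_F x); first exact: Pc.
rewrite !indicE (_ : (x \in E) = (x \in F)) //.
by apply/idP/idP => /set_mem /(EF x xi) /mem_set.
Qed.

Definition half_cylinder (j : 'I_d) (y : R) : set pt := [set x | 0 < cos (tnth x j - y)].

Lemma measurable_ltr_comp (f g : pt -> measurableTypeR R) :
  measurable_fun setT f -> measurable_fun setT g -> measurable [set x | f x < g x].
Proof.
move=> mf mg; have := measurable_fun_ltr mf mg => /(_ measurableT [set true] I).
by rewrite setTI; congr measurable; apply/seteqP; split=> x.
Qed.

Lemma trig_limit_half_cylinder j y : trig_limit_set (half_cylinder j y).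
Proof.
split.
  apply: measurable_ltr_comp => //.
  by apply: measurable_cosD; exact: measurable_tnth.
(* This rescales the cosine to [0, 1] so that it is positive exactly where u < 1 / 2, the jump of
   [step_poly]. *)
pose u (x : pt) : R := (1 - cos (tnth x j - y)) / 2.
have u01 x : 0 <= u x <= 1.
  by rewrite /u; have := cos_geN1 (tnth x j - y); have := cos_le1 (tnth x j - y); lra.
exists (fun n x => step_poly n (u x)); split.
- move=> n; apply: real_trig_polyX; apply: real_trig_polyB; first exact: real_trig_poly_cst.
  apply: real_trig_polyX; apply: real_trig_polyM; last exact: real_trig_poly_cst.
  by apply: real_trig_polyB; [exact: real_trig_poly_cst|exact: real_trig_poly_cos].
- by move=> n x; exact: step_poly_itv.
- move=> x _; rewrite indicE (_ : (x \in half_cylinder j y) = (u x < 2^-1)).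
    exact: cvg_step_poly.
  apply/idP/idP; rewrite /u.
    by move=> /set_mem; rewrite /half_cylinder /= => h; lra.
  by move=> h; apply/mem_set; rewrite /half_cylinder /=; lra.
Qed.

(** Inside the open cube a ray is cut out by two half-cylinders. The sign of sin (b - x_j) decides
    x_j < b only while |b - x_j| < pi, so a second half-cylinder first separates the half-periods
    x_j < pi and x_j > pi. For b <= pi the two conditions are intersected; for b > pi the same is
    done for the complement of the ray. *)
Lemma trig_limit_ray j (b : R) : trig_limit_set [set x | tnth x j < b].
Proof.
have mE : measurable [set x : pt | tnth x j < b].
  by apply: measurable_ltr_comp => //; exact: measurable_tnth.
have [b0|b0] := leP b 0.
  apply: (trig_limit_set_congr mE (trig_limit_setC trig_limit_setT)) => x /(_ j) h.
  by rewrite setCT /=; split=> //; lra.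
have [b2|b2] := leP (2 * pi) b.
  by apply: (trig_limit_set_congr mE trig_limit_setT) => x /(_ j) h; split=> //= _; lra.
have shiftE (t : R) : cos (t - (b - pi / 2)) = sin (b - t).
  have -> : t - (b - pi / 2) = - (b - t - pi / 2) by lra.
  by rewrite cosN cosBpihalf.
have pi0 := pi_gt0 R.
have [bpi|bpi] := leP b pi.
  apply: (trig_limit_set_congr mE (trig_limit_setI (trig_limit_half_cylinder j (pi / 2))
    (trig_limit_half_cylinder j (b - pi / 2)))) => x /(_ j) h.
  rewrite /= /half_cylinder /= shiftE cosBpihalf sin_gt0_period //.
  split=> [tb|[tpi]]; first by split; [|rewrite sin_gt0E]; lra.
  by rewrite sin_gt0E; lra.
apply: (trig_limit_set_congr mE (trig_limit_setC (trig_limit_setI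
  (trig_limit_half_cylinder j (- (pi / 2)))
  (trig_limit_setC (trig_limit_half_cylinder j (b - pi / 2)))))) => x /(_ j) h.
rewrite /= /half_cylinder /= shiftE opprK cosDpihalf sin_lt0_period //.
have [tpi|tpi] := leP (tnth x j) pi; first by split=> [_ []//|_]; lra.
rewrite sin_gt0E; last by lra.
by rewrite subr_gt0; split=> [tb []//|/not_andP[//|/contrapT]].
Qed.

Lemma preimage_tnth_trig_limit j (B : set (measurableTypeR R)) :
  measurable B -> <<s trig_limit_set >> ((fun x : pt => tnth x j) @^-1` B).
Proof.
rewrite [measurable]RGenInftyO.measurableE => mB.
have sG := smallest_sigma_algebra [set: pt] trig_limit_set.
pose H := [set B : set R | <<s trig_limit_set >> ((fun x : pt => tnth x j) @^-1` B)].
suff : <<s @RGenInftyO.G R >> `<=` H by exact.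
apply: smallest_sub.
  split; rewrite /H /=.
  - by rewrite preimage_set0; case: sG.
  - move=> A hA; rewrite setTD preimage_setC -setTD.
    by case: sG => _ + _; exact.
  - by move=> F hF; rewrite preimage_bigcup; case: sG => _ _; apply.
move=> A [b ->]; apply: sub_sigma_algebra.
rewrite (_ : _ @^-1` _ = [set x : pt | tnth x j < b]); first exact: trig_limit_ray.
by apply/seteqP; split=> x; rewrite /= in_itv.
Qed.

Lemma measurable_trig_limit E : measurable E -> <<s trig_limit_set >> E.
Proof.
move: E; apply: smallest_sub; first exact: smallest_sigma_algebra.
move=> E; rewrite -bigcup_seq => -[j _ [B mB <-]].
by rewrite setTI; exact: preimage_tnth_trig_limit.
Qed.

Definition cindic E (x : pt) : R[i] := (\1_E x)%:C.

Lemma sqmodC (c : R) : sqmod c%:C = c ^+ 2.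
Proof. by rewrite /sqmod /= expr0n addr0. Qed.

Lemma L2_real (g : pt -> measurableTypeR R) : measurable_fun setT g ->
  rintegrable (fun x => g x ^+ 2) -> L2_space d (fun x => (g x)%:C).
Proof.
move=> mg ig; apply/L2P; split=> //.
by under eq_fun do rewrite sqmodC.
Qed.

Lemma L2_cindic E : measurable E -> L2_space d (cindic E).
Proof.
move=> mE; have mi : measurable_fun setT (\1_E : pt -> measurableTypeR R) by exact: measurable_indic.
apply: L2_real => //; apply: (@bounded_integrable _ _ _ _ _ 1); first exact: measurable_funX.
by move=> x; rewrite indicE; case: (x \in E); rewrite /= ?expr1n ?expr0n ?normr1 ?normr0 ?lexx.
Qed.

Lemma trig_closure_cindic_limit E : trig_limit_set E -> trig_closure (cindic E).
Proof.
move=> [mE [P [Pt P01 Pc]]].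
apply: (@trig_closure_lim _ _ _ (fun n x => (P n x)%:C) (fun=> 1)).
- exact: L2_cindic.
- by move=> n; exact: (trig_closure_poly (Pt n)).
- exact: finite_measure_integrable_cst.
- move=> n x; rewrite /cindic -rmorphB /= sqmodC.
  have := P01 n x; have : 0 <= (\1_E x : R) <= 1.
    by rewrite indicE; case: (x \in E); rewrite /= ?lexx ?ler01.
  by nra.
exists (~` (@torus_interior R d)); split.
- by apply: measurableC; exact: measurable_torus_interior.
- exact: torus_interiorC.
- move=> x h xi; apply: h.
  have h : \1_E x - P n x @[n --> \oo] --> (0 : R).
    by rewrite -[X in _ --> X](subrr (\1_E x : R)); apply: cvgB (Pc x xi); exact: cvg_cst.
  rewrite /= (_ : (fun n => _) = (fun n => (\1_E x - P n x) * (\1_E x - P n x))).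
    by rewrite -[X in _ --> X](mulr0 (0 : R)); exact: cvgM.
  by apply/funext => n; rewrite /cindic -rmorphB /= sqmodC expr2.
Qed.

Lemma trig_closure_cindic E : measurable E -> trig_closure (cindic E).
Proof.
move=> /measurable_trig_limit; move: E.
(* Measurability is carried along because the indicator of an increasing union has to be recognised
   as an element of [L2_space]. *)
pose H := [set E | measurable E /\ trig_closure (cindic E)].
suff h : <<s trig_limit_set >> `<=` H by move=> E /h [].
apply: lambda_system_subset => //; first exact: trig_limit_setI; last first.
  by move=> E hE; split; [case: hE|exact: trig_closure_cindic_limit].
split=> //.
- by split=> //; exact: trig_closure_cindic_limit trig_limit_setT.
- move=> A B BA [mA cA] [mB cB]; split; first exact: measurableD.
  have -> : cindic (A `\` B) = (fun x => cindic A x - cindic B x).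
    apply/funext => x; rewrite /cindic !indicE in_setD -rmorphB /=; congr (_%:C).
    have [xB|xB] := boolP (x \in B); last by rewrite andbT subr0.
    by rewrite andbF (mem_set (BA _ (set_mem xB))) subrr.
  exact: trig_closureB.
- move=> F ndF hF; have mF i : measurable (F i) by case: (hF i).
  have mU : measurable (\bigcup_i F i) by exact: bigcupT_measurable.
  split=> //; apply: (@trig_closure_lim _ _ _ (fun n => cindic (F n)) (fun=> 1)).
  + exact: L2_cindic.
  + by move=> n; case: (hF n).
  + exact: finite_measure_integrable_cst.
  + move=> n x; rewrite /cindic -rmorphB /= sqmodC !indicE.
    by case: (_ \in _); case: (_ \in _); rewrite /= ?subrr ?subr0 ?sub0r ?sqrrN ?expr1n ?expr0n ?ler01.
  + apply: aeW => x; apply: cvg_near_cst; rewrite /cindic !indicE.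
    have [xU|xU] := boolP (x \in \bigcup_i F i); last first.
      near=> n; rewrite indicE (_ : (x \in F n) = false) ?subrr ?sqmodC ?expr0n //.
      by apply/negbTE; apply: contra xU => /set_mem xn; apply/mem_set; exists n.
    have [N _ xN] := set_mem xU; near=> n.
    rewrite indicE (mem_set (_ : F n x)) ?subrr ?sqmodC ?expr0n //.
    have Nn : (N <= n)%N by near: n; exact: nbhs_infty_ge.
    by have /subsetPset := ndF _ _ Nn; exact.
Unshelve. all: by end_near. Qed.

End pi_lambda.

(** * From indicators to square-integrable functions; Parseval's inequality *)

Section parseval.
Variables (R : realType) (d : nat).
Local Notation pt := (d.-tuple (measurableTypeR R)).
Local Notation mu := (torus_measure R d).
Local Notation Re := complex.Re.
Local Notation Im := complex.Im.
Implicit Types (f g p q : pt -> R[i]) (z a : R[i]) (k m : d.-tuple int) (l : seq (d.-tuple int)).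
Import HBSimple HBNNSimple.

Lemma trig_closure_sum (I : Type) (r : seq I) (F : I -> pt -> R[i]) :
  (forall i, trig_closure (F i)) -> trig_closure (fun x => \sum_(i <- r) F i x).
Proof.
move=> hF; elim: r => [|i r IH].
  by under eq_fun do rewrite big_nil; exact: trig_closure_poly (trig_poly_cst d 0).
by under eq_fun do rewrite big_cons; exact: trig_closureD.
Qed.

Lemma trig_closure_nnsfun (h : {nnsfun pt >-> R}) : trig_closure (fun x => (h x)%:C).
Proof.
have -> : (fun x => (h x)%:C) =
    (fun x => \sum_(y <- finmap.enum_fset (fset_set (range h))) y%:C * cindic (h @^-1` [set y]) x).
  apply/funext => x; rewrite fimfunE fsbig_finite //= rmorph_sum /=.
  by apply: eq_bigr => y _; rewrite rmorphM.
by apply: trig_closure_sum => y; apply: trig_closureZ; exact: trig_closure_cindic.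
Qed.

(** Simple functions between 0 and g leave a squared error of at most g^2, which is the dominating
    function. *)
Lemma trig_closure_nonneg (g : pt -> measurableTypeR R) : measurable_fun setT g ->
  (forall x, 0 <= g x) -> rintegrable (fun x => g x ^+ 2) -> trig_closure (fun x => (g x)%:C).
Proof.
move=> mg g0 ig; have mE : measurable_fun setT (EFin \o g) by exact/measurable_EFinP.
have g0' x : setT x -> (0 <= (EFin \o g) x)%E by move=> _; rewrite lee_fin.
pose h n := nnsfun_approx measurableT mE n.
have hg n x : 0 <= h n x <= g x.
  by rewrite fun_ge0 /= -lee_fin /h nnsfun_approxE le_approx.
apply: (@trig_closure_lim _ _ _ (fun n x => (h n x)%:C) _ _ _ ig).
- exact: L2_real.
- by move=> n; exact: trig_closure_nnsfun.
- move=> n x; rewrite -rmorphB /= sqmodC; have /andP[h0 hx] := hg n x.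
  by rewrite lerXn2r ?nnegrE ?subr_ge0 // gerBl.
- apply: aeW => x.
  have /fine_cvgP[_ c] := cvg_nnsfun_approx measurableT mE g0' (I : setT x).
  have c0 : g x - h n x @[n --> \oo] --> (0 : R).
    by rewrite -[X in _ --> X](subrr (g x)); apply: cvgB; [exact: cvg_cst|exact: c].
  rewrite (_ : (fun n => _) = (fun n => (g x - h n x) * (g x - h n x))).
    by rewrite -[X in _ --> X](mulr0 (0 : R)); exact: cvgM.
  by apply/funext => n; rewrite -rmorphB /= sqmodC expr2.
Qed.

Lemma trig_closure_real (g : pt -> measurableTypeR R) : measurable_fun setT g ->
  rintegrable (fun x => g x ^+ 2) -> trig_closure (fun x => (g x)%:C).
Proof.
move=> mg ig; have mN : measurable_fun setT (fun x => - g x : measurableTypeR R).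
  exact: measurableT_comp.
have part (u : pt -> measurableTypeR R) : measurable_fun setT u ->
    (forall x, u x ^+ 2 <= g x ^+ 2) -> trig_closure (fun x => (Num.max (u x) 0)%:C).
  move=> mu0 ug; have mm : measurable_fun setT (fun x => Num.max (u x) 0 : measurableTypeR R).
    by apply: measurable_maxr.
  apply: trig_closure_nonneg => //; first by move=> x; rewrite le_max lexx orbT.
  apply: le_rintegrable ig; first exact: measurable_funX.
  move=> x; rewrite ger0_norm ?sqr_ge0 //; apply: le_trans (ug x).
  by rewrite /Order.max; case: ifP => _; rewrite ?expr0n ?sqr_ge0.
have -> : (fun x => (g x)%:C) =
    (fun x => (Num.max (g x) 0)%:C - (Num.max (- g x) 0)%:C).
  apply/funext => x; rewrite -rmorphB /=; congr (_%:C).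
  by case: leP => h1; case: leP => h2; lra.
by apply: trig_closureB; apply: part => // x; rewrite ?sqrrN.
Qed.

Lemma trig_closure_L2 f : L2_space d f -> trig_closure f.
Proof.
move=> /L2P[mr mi i2].
have -> : f = (fun x => (Re (f x))%:C + 'i * (Im (f x))%:C).
  by apply/funext => x; apply: complex_eqP; rewrite /=; ring.
apply: trig_closureD; last apply: trig_closureZ; apply: trig_closure_real => //.
  apply: le_rintegrable i2; first exact: measurable_funX.
  by move=> x; rewrite ger0_norm ?sqr_ge0 // lerDl sqr_ge0.
apply: le_rintegrable i2; first exact: measurable_funX.
by move=> x; rewrite ger0_norm ?sqr_ge0 // lerDr sqr_ge0.
Qed.

(* Among the elements of the span of the modes in [l], the Fourier projection
   is the closest to [f]. *)
Lemma parseval_le f (e : R) : L2_space d f -> 0 < e ->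
  exists2 l, uniq l & sqnorm f <= \sum_(k <- l) sqmod (fourier_coef k f) + e.
Proof.
move=> fL e0; have [_ /(_ _ e0)[p pP]] := trig_closure_L2 fL.
have [l [c [ul ->]]] := trig_polyE pP.
rewrite sqnorm_sub_trig // => h; exists l => //.
have : \sum_(k <- l) (sqmod (fourier_coef k f) - sqmod (fourier_coef k f - c k)) <=
       \sum_(k <- l) sqmod (fourier_coef k f).
  by apply: ler_sum => k _; rewrite gerBl sqmod_ge0.
by lra.
Qed.

(** The constant must be 1, sharper than in [sqnormD]: it comes from |z + a|^2 <= (1 + t) |z|^2 + (1
    + 1 / t) |a|^2 with t arbitrarily small, the second term integrating to 0. *)
Lemma sqnormD_null f g : L2_space d f -> L2_space d g -> sqnorm g = 0 ->
  sqnorm (fun x => f x + g x) <= sqnorm f.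
Proof.
move=> fL gL g0; apply/ler_addgt0Pr => e e0.
have fP : 0 < sqnorm f + 1 by rewrite ltr_wpDl ?sqnorm_ge0.
(* Chosen so that t * [sqnorm f] <= e; the added 1 keeps the denominator positive. *)
pose t := e / (sqnorm f + 1); have t0 : 0 < t by rewrite divr_gt0.
have h z a : sqmod (z + a) <= (1 + t) * sqmod z + (1 + t^-1) * sqmod a.
  have s0 : 0 < t^-1 by rewrite invr_gt0.
  have st : t^-1 * t = 1 by rewrite mulVf // gt_eqF.
  case: z a => x y [u v]; rewrite /sqmod /=.
  have h1 w1 w2 : 2 * w1 * w2 <= t * w1 ^+ 2 + t^-1 * w2 ^+ 2.
    rewrite -subr_ge0.
    have -> : t * w1 ^+ 2 + t^-1 * w2 ^+ 2 - 2 * w1 * w2 = t^-1 * (t * w1 - w2) ^+ 2.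
      by field; rewrite gt_eqF.
    by rewrite mulr_ge0 ?sqr_ge0 // ltW.
  by have := h1 x u; have := h1 y v; lra.
have /L2P[_ _ si] := L2D fL gL.
move: (fL) (gL) => /L2P[_ _ fi] /L2P[_ _ gi].
have : sqnorm (fun x => f x + g x) <= (1 + t) * sqnorm f + (1 + t^-1) * sqnorm g.
  rewrite /sqnorm -!RintegralZl // -RintegralD //; [|exact: rintegrableZ|exact: rintegrableZ].
  by apply: le_Rintegral => //; apply: rintegrableD; exact: rintegrableZ.
rewrite g0 mulr0 addr0 => /le_trans; apply.
rewrite mulrDl mul1r lerD2l /t mulrAC ler_pdivrMr // ler_wpM2l ?(ltW e0) //.
  by rewrite lerDl.
Qed.

Lemma L2_norm_sqnorm f : L2_space d f -> L2_norm f = (sqnorm f `^ 2^-1)%:E.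
Proof. by move=> fL; rewrite L2_normE sqnormE. Qed.

Lemma L2_norm_eq0 f : L2_space d f -> L2_norm f = 0%E <-> sqnorm f = 0.
Proof.
move=> fL; rewrite L2_norm_sqnorm //; split=> [[/eqP]|->]; last by rewrite powR0 // invr_neq0.
by rewrite powR_eq0 => /andP[/eqP].
Qed.

Definition mix_weight (s : R) k : R := \prod_(j < d) (1 + `|(tnth k j)%:~R| ^+ 2) `^ s.

Lemma mix_weight_ge0 s k : 0 <= mix_weight s k.
Proof. by apply: prodr_ge0 => j _; exact: powR_ge0. Qed.

Lemma Hmix_normE s f : Hmix_norm s f =
  ((\esum_(k in [set: d.-tuple int]) (sqmod (fourier_coef k f) * mix_weight s k)%:E) `^ 2^-1)%E.
Proof.
rewrite /Hmix_norm; congr (_ `^ _)%E; apply: eq_esum => k _; congr (_%:E).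
by rewrite sqr_normcE.
Qed.

Lemma sum_le_Hmix s f l : uniq l -> 0 < s ->
  (((\sum_(k <- l) sqmod (fourier_coef k f) * mix_weight s k) `^ 2^-1)%:E <= Hmix_norm s f)%E.
Proof.
move=> ul s0; rewrite Hmix_normE -poweR_EFin.
have a0 k : 0 <= sqmod (fourier_coef k f) * mix_weight s k.
  by rewrite mulr_ge0 ?sqmod_ge0 ?mix_weight_ge0.
apply: gt0_ler_poweR; rewrite ?in_itv /= ?leey ?andbT ?lee_fin ?invr_ge0 //.
- by apply: sumr_ge0.
- by apply: esum_ge0 => k _; rewrite lee_fin.
apply: esum_ge; exists [set` l]; first by split=> //; exact: finite_seq.
by rewrite -fsbig_seq // sumEFin.
Qed.

Lemma Hmix_finite s f l : uniq l -> (forall k, k \notin l -> fourier_coef k f = 0) ->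
  Hmix_norm s f = ((\sum_(k <- l) sqmod (fourier_coef k f) * mix_weight s k) `^ 2^-1)%:E.
Proof.
move=> ul h; rewrite Hmix_normE -poweR_EFin; congr (_ `^ _)%E.
rewrite -sumEFin fsbig_seq // -esum_fset.
- rewrite [RHS]esum_mkcond; apply: eq_esum => k _.
  case: ifPn => // kl; rewrite h ?sqmodC ?expr0n ?mul0r //.
  by apply: contra kl => kl; exact/mem_set.
- exact: finite_seq.
- by move=> k _; rewrite lee_fin mulr_ge0 ?sqmod_ge0 ?mix_weight_ge0.
Qed.

End parseval.

(** * The two estimates *)

Section upper_bound.
Variables (R : realType) (d : nat) (s : R).
Hypothesis s0 : 0 < s.
Local Notation pt := (d.-tuple (measurableTypeR R)).
Local Notation mu := (torus_measure R d).
Local Notation Re := complex.Re.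
Local Notation Im := complex.Im.
Implicit Types (f g p q : pt -> R[i]) (z a : R[i]) (k m : d.-tuple int) (l : seq (d.-tuple int)).

Lemma L2_norm0 : L2_norm (fun _ : pt => 0 : R[i]) = 0%E.
Proof.
by apply/(L2_norm_eq0 (L2_cst d 0)); rewrite /sqnorm Rintegral_cst // sqmodC expr0n mul0r.
Qed.

Lemma mix_weight_ge1 k : 1 <= mix_weight s k.
Proof.
apply: (big_ind (fun x : R => 1 <= x)) => // [x y x1 y1|j _]; first exact: mulr_ege1.
apply: (@le_trans _ _ (1 `^ s)); first by rewrite powR1.
rewrite ge0_ler_powR ?nnegrE ?(ltW s0) // ?addr_ge0 ?exprn_ge0 //.
by rewrite lerDl exprn_ge0.
Qed.

Definition fourier_proj l f : pt -> R[i] := trig l (fun k => fourier_coef k f).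

(** The remainder has coefficient 0 on [l] and that of [f] elsewhere, where |c_k|^2 <= w |c_k|^2
    [mix_weight s k]. Summation against the unit bound on the mixed norm gives w for the squared
    norm. *)
Lemma fourier_proj_rest_le l (w : R) f : uniq l -> 0 <= w ->
  (forall k, k \notin l -> 1 <= w * mix_weight s k) ->
  L2_space d f -> (Hmix_norm s f <= 1)%E ->
  (L2_norm (fun x => (f x - fourier_proj l f x)%R) <= (w `^ 2^-1)%:E)%E.
Proof.
move=> ul w0 wl fL f1; pose g x := f x - fourier_proj l f x.
have gL : L2_space d g by apply: L2B => //; exact: L2_trig.
rewrite L2_norm_sqnorm // lee_fin ge0_ler_powR ?nnegrE ?invr_ge0 ?sqnorm_ge0 //.
(* Parseval's inequality is available up to an error e, so the bound is shown up to every positive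
   e. *)
apply/ler_addgt0Pr => e e0; have [l' ul' h] := parseval_le gL e0.
apply: le_trans h _; rewrite lerD2r.
have : \sum_(k <- l') sqmod (fourier_coef k f) * mix_weight s k <= 1.
  have := le_trans (sum_le_Hmix f ul' s0) f1; rewrite lee_fin.
  set S := \sum_(k <- l') _ => h; rewrite leNgt; apply/negP => S1; move: h; apply/negP.
  rewrite -ltNge; apply: (@le_lt_trans _ _ (1 `^ 2^-1)); first by rewrite powR1.
  rewrite gt0_ltr_powR ?nnegrE ?invr_gt0 //.
  by rewrite (le_trans ler01) // ltW.
move=> h; rewrite -[leRHS]mulr1; apply: le_trans (ler_wpM2l w0 h).
rewrite mulr_sumr; apply: ler_sum => k _.
rewrite fourier_coef_sub //; last exact: L2_trig.
rewrite fourier_coef_trig //; case: ifPn => kl.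
  by rewrite subrr sqmodC expr0n /= mulr_ge0 // mulr_ge0 ?sqmod_ge0 ?mix_weight_ge0.
by rewrite subr0 mulrCA ler_peMr ?sqmod_ge0 // wl.
Qed.

Lemma fourier_proj_bounded l : uniq l ->
  bounded_linear_operator (Hmix d s) (Hmix_norm s) (L2_space d) L2_norm (fourier_proj l).
Proof.
move=> ul; split.
- by move=> f _; exact: L2_trig.
- move=> a f g [fL _] [gL _]; rewrite (_ : (_ - _)%R = fun=> 0).
    exact: L2_norm0.
  apply/funext => x; apply/eqP; rewrite subr_eq0; apply/eqP.
  rewrite -[RHS]/(a * fourier_proj l f x + fourier_proj l g x).
  rewrite /fourier_proj /trig mulr_sumr -big_split /=; apply: eq_bigr => k _.
  have -> : fourier_coef k (a *: f + g) = a * fourier_coef k f + fourier_coef k g.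
    exact: fourier_coef_lin.
  by rewrite mulrDl -mulrA.
- exists 1 => f [fL _]; rewrite mul1e; apply: le_trans (sum_le_Hmix f ul s0).
  rewrite L2_norm_sqnorm; last exact: L2_trig.
  rewrite lee_fin ge0_ler_powR ?nnegrE ?invr_ge0 ?sqnorm_ge0 //.
    by apply: sumr_ge0 => k _; rewrite mulr_ge0 ?sqmod_ge0 ?mix_weight_ge0.
  rewrite sqnorm_trig //; apply: ler_sum => k _.
  by rewrite ler_peMr ?sqmod_ge0 ?mix_weight_ge1.
Qed.

Lemma fourier_proj_rank l n : (size l < n)%N ->
  rank_lt (Hmix d s) (L2_space d) L2_norm (fourier_proj l) n.
Proof.
move=> ln; exists (size l) => //; exists (fun i => mode (tnth (in_tuple l) i)).
split; first by move=> i; exact: L2_mode.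
move=> f _; exists (fun i => fourier_coef (tnth (in_tuple l) i) f).
rewrite (_ : (_ - _)%R = fun=> 0).
  exact: L2_norm0.
apply/funext => x; apply/eqP; rewrite subr_eq0; apply/eqP.
by rewrite /fourier_proj /trig /= big_tnth fct_sumE.
Qed.

Lemma approximation_number_le l n (w : R) : uniq l -> (size l < n)%N -> 0 <= w ->
  (forall k, k \notin l -> 1 <= w * mix_weight s k) ->
  (approximation_number (Hmix d s) (Hmix_norm s) (L2_space d) L2_norm n id
     <= (w `^ 2^-1)%:E)%E.
Proof.
move=> ul ln w0 wl.
apply: (@le_trans _ _ (operator_norm (Hmix d s) (Hmix_norm s) L2_norm
  (fun f => f - fourier_proj l f))).
  apply: ereal_inf_lbound; exists (fourier_proj l) => //.
  by split; [exact: fourier_proj_bounded|exact: fourier_proj_rank].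
by apply: ge_ereal_sup => _ [f [[fL _] f1] <-]; exact: fourier_proj_rest_le.
Qed.

End upper_bound.

Section lower_bound.
Variables (R : realType) (d : nat) (s : R).
Hypothesis s0 : 0 < s.
Local Notation pt := (d.-tuple (measurableTypeR R)).
Local Notation mu := (torus_measure R d).
Local Notation Re := complex.Re.
Local Notation Im := complex.Im.
Implicit Types (f g p q u v : pt -> R[i]) (z a : R[i]) (k : d.-tuple int) (l : seq (d.-tuple int)).

(** The ambient functions are representatives; equality in the quotient space means that the
    difference is of this kind. *)
Definition null u := L2_space d u /\ sqnorm u = 0.

Lemma nullD u v : null u -> null v -> null (fun x => u x + v x).
Proof.
move=> [uL u0] [vL v0]; split; first exact: L2D.
by apply/eqP; rewrite eq_le sqnorm_ge0 andbT -[leRHS]u0; exact: sqnormD_null.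
Qed.

Lemma nullZ a u : null u -> null (fun x => a * u x).
Proof. by move=> [uL u0]; split; [exact: L2Z|rewrite sqnormZ // u0 mulr0]. Qed.

Lemma null0 : null (fun=> 0).
Proof. by split; [exact: L2_cst|apply/(L2_norm_eq0 (L2_cst d 0)); exact: L2_norm0]. Qed.

Lemma null_sum (I : Type) (r : seq I) (F : I -> pt -> R[i]) :
  (forall i, null (F i)) -> null (fun x => \sum_(i <- r) F i x).
Proof.
move=> hF; elim: r => [|i r IH].
  by under eq_fun do rewrite big_nil; exact: null0.
by under eq_fun do rewrite big_cons; exact: nullD.
Qed.

Lemma Hmix_trig l (c : d.-tuple int -> R[i]) : uniq l ->
  Hmix_norm s (trig l c) = ((\sum_(k <- l) sqmod (c k) * mix_weight s k) `^ 2^-1)%:E.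
Proof.
move=> ul; rewrite (@Hmix_finite _ _ _ _ l) //; last first.
  by move=> k /negPf kl; rewrite fourier_coef_trig // kl.
congr (_ `^ _)%:E; rewrite big_seq [RHS]big_seq; apply: eq_bigr => k kl.
by rewrite fourier_coef_trig // kl.
Qed.

Lemma Hmix_space_trig l c : uniq l -> Hmix d s (trig l c).
Proof. by move=> ul; split; [exact: L2_trig|rewrite Hmix_trig // ltry]. Qed.

Lemma trig_cons k l c : trig (k :: l) c = c k *: mode k + trig l c :> (pt -> R[i]).
Proof. by apply/funext => x; rewrite /trig big_cons. Qed.

Lemma Hmix_space_mode k : Hmix d s (mode k).
Proof.
have := @Hmix_space_trig [:: k] (fun=> 1) isT; congr (Hmix d s _).
by apply/funext => x; rewrite /trig big_seq1 mul1r.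
Qed.

Section operator.
Variable A : (pt -> R[i]) -> (pt -> R[i]).
Hypothesis AL2 : forall f, Hmix d s f -> L2_space d (A f).
Hypothesis Alin : forall a f g, Hmix d s f -> Hmix d s g ->
  L2_norm (A (a *: f + g) - (a *: A f + A g)) = 0%E.

Lemma operator_trig_null l c : uniq l ->
  null (fun x => A (trig l c) x - \sum_(k <- l) c k * A (mode k) x).
Proof.
have linnull a f g : Hmix d s f -> Hmix d s g -> Hmix d s (a *: f + g) ->
    null (fun x => A (a *: f + g) x - (a * A f x + A g x)).
  move=> fX gX afgX; have L : L2_space d (fun x => A (a *: f + g) x - (a * A f x + A g x)).
    by apply: L2B; [exact: AL2|apply: L2D; [apply: L2Z|]; exact: AL2].
  by split=> //; apply/(L2_norm_eq0 L); exact: Alin.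
elim: l => [|k l IH] /= => [_|/andP[kl ul]].
  have t0 : trig [::] c = (fun=> 0) :> (pt -> R[i]) by apply/funext => x; rewrite /trig big_nil.
  have X0 : Hmix d s (fun _ : pt => 0) by rewrite -t0; exact: Hmix_space_trig.
  (* Linearity at this combination says that A 0 is null, since -A 0 + A 0 cancels pointwise. *)
  have e : (-1 : R[i]) *: (fun _ : pt => 0 : R[i]) + (fun=> 0) = (fun=> 0).
    by apply/funext => x; rewrite /= scaler0 addr0.
  have := linnull (-1) _ _ X0 X0; rewrite e => /(_ X0).
  congr null; apply/funext => x.
  by rewrite t0 big_nil mulN1r addNr.
have := linnull (c k) _ _ (Hmix_space_mode k) (Hmix_space_trig c ul).
rewrite -trig_cons => /(_ (@Hmix_space_trig (k :: l) c _)).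
rewrite /= kl => /(_ ul) h; have := nullD h (IH ul); congr null; apply/funext => x.
by rewrite big_cons; ring.
Qed.

(* The matrix [M] of [A] on the modes in [l], relative to fewer than [size l]
   vectors, has a nonzero left kernel. *)
Lemma rank_lt_kernel l n : uniq l -> size l = n ->
  rank_lt (Hmix d s) (L2_space d) L2_norm A n ->
  exists2 c : d.-tuple int -> R[i], \sum_(k <- l) sqmod (c k) != 0 &
    forall t : R, null (A (trig l (fun k => t%:C * c k))).
Proof.
move=> ul <- [m ml [g [gL hg]]].
have /choice[C hC] : forall k, exists cc : 'I_m -> R[i],
    null (fun x => A (mode k) x - \sum_(i < m) cc i * g i x).
  move=> k; have [cc hc] := hg _ (Hmix_space_mode k); exists cc.
  have E : (fun x => A (mode k) x - \sum_(i < m) cc i * g i x) =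
      A (mode k) - \sum_(i < m) cc i *: g i.
    by apply/funext => x; rewrite /= fct_sumE.
  have L : L2_space d (fun x => A (mode k) x - \sum_(i < m) cc i * g i x).
    apply: L2B; first by apply: AL2; exact: Hmix_space_mode.
    elim: (index_enum _) => [|i r IH].
      by under eq_fun do rewrite big_nil; exact: L2_cst.
    by under eq_fun do rewrite big_cons; apply: L2D => //; exact: L2Z.
  by split=> //; apply/(L2_norm_eq0 L); rewrite E.
pose M : 'M[R[i]]_(size l, m) := \matrix_(i, j) C (tnth (in_tuple l) i) j.
have /rowV0Pn[v /sub_kermxP vM v0] : kermx M != 0.
  rewrite -mxrank_eq0 mxrank_ker -lt0n subn_gt0.
  exact: leq_ltn_trans (rank_leq_col _) ml.
have [i0 vi0] : exists i, v 0 i != 0.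
  by move: v0 => /rV0Pn[i hi]; exists i.
(* Outside [l] the index falls back to [i0]; sums over [l] do not see that value. *)
pose b k := v 0 (insubd i0 (index k l)).
have bE i : b (tnth (in_tuple l) i) = v 0 i.
  congr (v 0 _); apply: val_inj; rewrite val_insubd (tnth_nth (tnth (in_tuple l) i)) /=.
  by rewrite index_uniq ?ltn_ord.
have bM j : \sum_(k <- l) b k * C k j = 0.
  have e : (v *m M) 0 j = 0 by rewrite vM mxE.
  by rewrite -[RHS]e mxE big_tnth; apply: eq_bigr => i _; rewrite bE mxE.
exists b.
  rewrite big_tnth gt_eqF //; apply: (@lt_le_trans _ _ (sqmod (b (tnth (in_tuple l) i0)))).
    rewrite lt_neqAle sqmod_ge0 andbT eq_sym bE; move: vi0; apply: contra.
    rewrite paddr_eq0 ?sqr_ge0 // !sqrf_eq0 => /andP[/eqP h1 /eqP h2].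
    by apply/eqP; apply: complex_eqP.
  rewrite (bigD1 i0) //= lerDl; apply: sumr_ge0 => i _; exact: sqmod_ge0.
move=> t; have h1 := operator_trig_null (fun k => t%:C * b k) ul.
have h2 : null (fun x => \sum_(k <- l) (t%:C * b k) *
    (A (mode k) x - \sum_(i < m) C k i * g i x)).
  by apply: null_sum => k; exact: nullZ.
have := nullD h1 h2; congr null; apply/funext => x.
have -> : \sum_(k <- l) (t%:C * b k) * (A (mode k) x - \sum_(i < m) C k i * g i x) =
   \sum_(k <- l) (t%:C * b k) * A (mode k) x.
  under eq_bigr do rewrite mulrBr.
  rewrite sumrB [X in _ - X](_ : _ = 0) ?subr0 //.
  under eq_bigr do rewrite mulr_sumr.
  rewrite exchange_big big1 //= => i _.
  under eq_bigr do rewrite mulrA -[_ * C _ _]mulrA.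
  by rewrite -mulr_suml -mulr_sumr bM mulr0 mul0r.
by rewrite subrK.
Qed.

End operator.

(** The kernel function f is a combination of modes of weight at most w, so its squared mixed norm
    is at most w times its squared L_2 norm. As A f is null, f - A f is no smaller than f. *)
Lemma approximation_number_ge l n (w : R) : uniq l -> size l = n -> 0 < w ->
  (forall k, k \in l -> mix_weight s k <= w) ->
  ((w^-1 `^ 2^-1)%:E <=
    approximation_number (Hmix d s) (Hmix_norm s) (L2_space d) L2_norm n id)%E.
Proof.
move=> ul ln w0 wl; apply: le_ereal_inf_tmp => _ [A [[AL2 Alin _] rA] <-].
have [c c0 hc] := rank_lt_kernel AL2 Alin ul ln rA.
set S := \sum_(k <- l) _ in c0.
have S0 : 0 < S by rewrite lt_neqAle eq_sym c0 sumr_ge0 // => k _; exact: sqmod_ge0.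
(* Scaling by t makes the squared L_2 norm of [f] equal to 1 / w, which puts [f] into the unit ball
   of the mixed space. *)
pose t := Num.sqrt (w * S)^-1; pose f := trig l (fun k => t%:C * c k).
have t2 : t ^+ 2 = (w * S)^-1 by rewrite sqr_sqrtr // invr_ge0 mulr_ge0 ?ltW.
have If : sqnorm f = w^-1.
  rewrite sqnorm_trig // (eq_bigr (fun k => t ^+ 2 * sqmod (c k))); last first.
    by move=> k _; rewrite sqmodM sqmodC.
  by rewrite -mulr_sumr t2 -/S invfM mulfVK.
have fX : Hmix d s f by exact: Hmix_space_trig.
have f1 : (Hmix_norm s f <= 1)%E.
  rewrite Hmix_trig // lee_fin; apply: (@le_trans _ _ (1 `^ 2^-1)); last by rewrite powR1.
  have W0 k : 0 <= sqmod (t%:C * c k) * mix_weight s k.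
    by rewrite mulr_ge0 ?sqmod_ge0 ?mix_weight_ge0.
  rewrite ge0_ler_powR ?nnegrE ?invr_ge0 //; first by apply: sumr_ge0.
  apply: (@le_trans _ _ (w * sqnorm f)); last by rewrite If divff // gt_eqF.
  rewrite sqnorm_trig // mulr_sumr big_seq [leRHS]big_seq; apply: ler_sum => k kl.
  by rewrite mulrC ler_wpM2r ?sqmod_ge0 ?wl.
have [AL A0] := hc t; rewrite -/f in AL A0.
have fL : L2_space d f by case: fX.
have fAL : L2_space d (fun x => f x - A f x) by exact: L2B.
apply: (@le_trans _ _ (L2_norm (fun x => f x - A f x))); last first.
  by apply: ereal_sup_ubound; exists f.
rewrite L2_norm_sqnorm // lee_fin ge0_ler_powR ?nnegrE ?invr_ge0 ?sqnorm_ge0 ?(ltW w0) //.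
rewrite -If; have := sqnormD_null fAL AL A0; congr (sqnorm _ <= _).
by apply/funext => x; rewrite subrK.
Qed.

(** Factorwise this is 1 + x^2 <= (1 + |x|)^2. The induction over the product carries nonnegativity
    along, which the multiplicativity of real powers requires. *)
Lemma mix_weight_le k : mix_weight s k <= ((cross_weight k)%:R ^+ 2) `^ s.
Proof.
rewrite /cross_weight natr_prod -prodrXl /mix_weight.
suff [] : [/\ 0 <= mix_weight s k, 0 <= \prod_(j < d) (absz (tnth k j)).+1%:R ^+ 2 :> R &
  mix_weight s k <= (\prod_(j < d) (absz (tnth k j)).+1%:R ^+ 2) `^ s] by [].
apply: (big_rec2 (fun x y : R => [/\ 0 <= x, 0 <= y & x <= y `^ s])); first by rewrite powR1.
move=> j x y _ [x0 y0 xy]; rewrite !mulr_ge0 ?exprn_ge0 ?powR_ge0 //; split=> //.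
rewrite powRM ?exprn_ge0 //; apply: ler_pM => //.
rewrite ge0_ler_powR ?nnegrE ?(ltW s0) ?addr_ge0 ?exprn_ge0 //.
have -> : `|(tnth k j)%:~R| = (absz (tnth k j))%:R :> R.
  by rewrite -intr_norm -abszE -pmulrn.
by rewrite -natr1; have : 0 <= (absz (tnth k j))%:R :> R by []; nra.
Qed.

End lower_bound.

Theorem theorem4p16 (R : realType) (d : nat) (s : R) (n : nat) :
  (2 <= d)%N -> 0 < s -> (2 <= n)%N -> n%:R <= d%:R / 2 * 4 ^+ d :> R ->
  ((2 `^ (- s) * (1 / n%:R) `^ (s / alpha n d))%:E
     <= approximation_number (Hmix d s) (Hmix_norm s) (L2_space d) L2_norm n id
     <= ((expR 1 ^+ 2 / n%:R) `^ (s / (4 + 2 * log2 d%:R)))%:E)%E.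
Proof.
move=> d2 s0 n2 nd; have n0 : 0 < n%:R :> R by rewrite ltr0n ltnW.
apply/andP; split.
  have [a0 [m nm rm]] := cross_level d2 n2 nd.
  have [l [ul lw ls]] := hyperbolic_cross_seq m d.
  pose r : R := 2 * n%:R `^ (alpha n d)^-1.
  have r0 : 0 < r by rewrite mulr_gt0 // powR_gt0.
  pose w : R := (r ^+ 2) `^ s.
  have w0 : 0 < w by rewrite powR_gt0 // exprn_gt0.
  have -> : 2 `^ (- s) * (1 / n%:R) `^ (s / alpha n d) = w^-1 `^ 2^-1.
    rewrite -powRN -powRrM -(powR_mulrn 2 (ltW r0)) -powRrM.
    have -> : 2%:R * (- s * 2^-1) = - s by field.
    rewrite /r powRM ?powR_ge0 // -powRrM; congr (_ * _).
    rewrite div1r -[n%:R^-1]powR_inv1 // -powRrM; congr (_ `^ _).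
    by field; rewrite gt_eqF.
  (* Exactly n modes are kept, to be set against operators of rank less than n. *)
  have us : uniq (take n l) by exact: take_uniq.
  apply: (approximation_number_ge us) => //.
    by rewrite size_takel // ls.
  move=> k /mem_take kl; apply: le_trans (mix_weight_le s0 k) _.
  rewrite ge0_ler_powR ?nnegrE ?(ltW s0) ?exprn_ge0 ?(ltW r0) //.
  rewrite lerXn2r ?nnegrE ?(ltW r0) //; apply: le_trans rm.
  by rewrite -natrX ler_nat lw.
have [l [ul ln lw]] := large_weight_seq R (ltnW d2) (ltnW n2).
set e := expR 1 ^+ 2 / n%:R in lw *.
have e0 : 0 < e by rewrite divr_gt0 ?exprn_gt0 ?expR_gt0.
pose p : R := 2 + log2 d%:R.
have p0 : 0 < p by rewrite ltr_wpDr // log2_ge0 // ltnW.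
have -> : e `^ (s / (4 + 2 * log2 d%:R)) = (e `^ (s / p)) `^ 2^-1.
  rewrite -powRrM; congr (_ `^ _).
  have -> : 4 + 2 * log2 d%:R = 2 * p :> R by rewrite /p; ring.
  by field; rewrite gt_eqF.
apply: (approximation_number_le s0 ul ln) => [|k kl]; first exact: powR_ge0.
have V0 : 0 <= \prod_(j < d) (1 + `|(tnth k j)%:~R| ^+ 2) `^ (- p) :> R.
  by apply: prodr_ge0 => j _; exact: powR_ge0.
(* Both weights are powers of the same product: raising the one with exponent -p to the power s / p
   inverts [mix_weight s k]. *)
have h : (\prod_(j < d) (1 + `|(tnth k j)%:~R| ^+ 2) `^ (- p)) `^ (s / p) * mix_weight s k = 1.
  rewrite /mix_weight.
  have : 0 <= \prod_(j < d) (1 + `|(tnth k j)%:~R| ^+ 2) `^ (- p) :> R /\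
    (\prod_(j < d) (1 + `|(tnth k j)%:~R| ^+ 2) `^ (- p)) `^ (s / p) *
    \prod_(j < d) (1 + `|(tnth k j)%:~R| ^+ 2) `^ s = 1 :> R.
    apply: (big_rec2 (fun x y : R => 0 <= x /\ x `^ (s / p) * y = 1)).
      by rewrite powR1 mulr1.
    move=> j x y _ [x0 xy]; rewrite mulr_ge0 ?powR_ge0 //; split=> //.
    rewrite powRM ?powR_ge0 // mulrACA xy mulr1 -powRrM -powRD.
      rewrite (_ : - p * (s / p) + s = 0) ?powRr0 //.
      by rewrite mulNr mulrCA divff ?mulr1 ?addNr // gt_eqF.
    by rewrite (_ : 1 + _ != 0) ?implybT // gt_eqF // ltr_wpDr // exprn_ge0.
  by case.
rewrite -h ler_wpM2r ?mix_weight_ge0 // ge0_ler_powR ?nnegrE ?(ltW e0) //.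
  by rewrite ltW // divr_gt0.
exact: lw.
Qed.
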